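(* Consider the $d$-dimensional risk model described in the context, with discounted surplus process ${\bf U}$, and let $L\subset\mathbb{R}^d$ be a ruin set, i.e. $L$ is open, decreasing, $L^c$ is convex, ${\bf 0}\in\partial L$, and $xL=L$ for every $x>0$. Put $A=({\bf l}-L)=\{{\bf l}-{\bf y}:{\bf y}\in L\}\in\mathscr{R}$. Suppose the following. (i) For every $T\in(0,\infty)$ there exist constants $C_2\ge C_1\ge 0$ (depending on $T$) such that $\mathbf{P}\left[\inf_{0\le t\le T}\xi(t)\ge -C_1\right]=1$ and $\mathbf{P}\left[\sup_{0\le t\le T}\xi(t)\le C_2\right]=1$. (ii) The claim vectors ${\bf X}^{(i)}$, $i\in\mathbb{N}$, are identically distributed with common distribution $F\in(\mathcal{D}\cap\mathcal{L})_A$, and for all $i\ne j$ the vectors ${\bf X}^{(i)},{\bf X}^{(j)}$ are tail asymptotically independent on $A$, i.e. with $Y_A^{(i)}:=\sup\{u:{\bf X}^{(i)}\in uA\}$, $$\lim_{x_i\wedge x_j\to\infty}\mathbf{P}\left[Y_A^{(i)}>x_i\,\middle|\,Y_A^{(j)}>x_j\right]=0 .$$ (iii) $\{{\bf X}^{(i)},\,i\in\mathbb{N}\}$, $\{N(t),\,t\ge0\}$, $\{\xi(t),\,t\ge0\}$ and $\{{\bf c}(t),\,t\ge0\}$ are mutually independent. Then the ruin probability $\psi_{{\bf l},L}(x;t):=\mathbf{P}\left[{\bf U}(s)\in L\text{ for some }s\in(0,t]\right]$ satisfies, for any fixed $T>0$, $$\psi_{{\bf l},L}(x;t)\sim\int_0^t\mathbf{P}\left[{\bf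 X}\,e^{-\xi(s)}\in xA\right]\lambda(ds),\qquad x\to\infty,$$ uniformly for $t\in\Lambda_T$, where ${\bf X}$ denotes a random vector with distribution $F$, independent of $\{\xi(t),\,t\ge0\}$.
   Context: Risk model. Fix $d\in\mathbb{N}$. Claim vectors ${\bf X}^{(i)}=(X^{(i)}_1,\dots,X^{(i)}_d)$, $i\in\mathbb{N}$, take values in $[0,\infty)^d\setminus\{{\bf 0}\}$ (some components may be zero, but not all); the dependence among the components of each vector is arbitrary. The $i$-th claim vector arrives at time $T_i$ ($T_0=0$), where $(T_i)$ are the arrival times of a renewal counting process $\{N(t),t\ge0\}$ with finite renewal function $\lambda(t)=\mathbf{E}[N(t)]=\sum_{i\ge1}\mathbf{P}[T_i\le t]$. $\{\xi(t),t\ge0\}$ is a càdlàg stochastic process with $\xi(0)=0$ (the investment portfolio price process is $e^{\xi(t)}$). ${\bf c}(t)=(c_1(t),\dots,c_d(t))$ is the premium density, with $0\le c_i(t)\le M_i$ for all $t\ge0$ and some constants $M_i\ge0$. The total initial capital is $x>0$, allocated by weights ${\bf l}=(l_1,\dots,l_d)$ with $l_i>0$, $l_1+\cdots+l_d=1$. The discounted surplus process is $${\bf U}(t)=x\,{\bf l}+\int_{0-}^te^{-\xi(s)}{\bf c}(s)\,ds-\sum_{i=1}^{N(t)}{\bf X}^{(i)}e^{-\xi(T_i)},\qquad t\ge0,$$ with integrals and sums taken componentwise. Time sets. $\Lambda=\{t:\lambda(t)>0\}$ and $\Lambda_T=(0,T]\cap\Lambda$. Integrals $\int_0^t\cdot\,\lambda(ds)$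 are Lebesgue–Stieltjes integrals over $[0,t]$. Sets. A set $A\subset\mathbb{R}^d$ is increasing if ${\bf x}\in A$, ${\bf y}\in[0,\infty)^d$ imply ${\bf x}+{\bf y}\in A$; $L$ is decreasing if $-L$ is increasing. $\mathscr{R}$ is the family of sets $A\subsetneq\mathbb{R}^d$ that are open, increasing, with $A^c$ convex and ${\bf 0}\notin\overline{A}$. $xA=\{x{\bf a}:{\bf a}\in A\}$. Distribution classes. For ${\bf X}$ with distribution $F$ on $[0,\infty)^d$ and $A\in\mathscr{R}$, $F_A$ denotes the distribution of $Y_A=\sup\{u:{\bf X}\in uA\}$; its tail is $\overline{F_A}(x)=\mathbf{P}[{\bf X}\in xA]$ for $x>0$. All univariate distributions considered have infinite right endpoint (tail positive everywhere). A univariate distribution $V$ with tail $\overline V=1-V$ belongs to $\mathcal{L}$ if $\lim_{x\to\infty}\overline V(x-a)/\overline V(x)=1$ for every $a>0$, and to $\mathcal{D}$ if $\limsup_{x\to\infty}\overline V(bx)/\overline V(x)<\infty$ for every $b\in(0,1)$. $F\in(\mathcal{D}\cap\mathcal{L})_A$ means $F_A\in\mathcal{D}\cap\mathcal{L}$. Asymptotics. $f(x;t)\sim g(x;t)$ uniformly for $t\in\Delta$ means $\lim_{x\to\infty}\sup_{t\in\Delta}|f(x;t)/g(x;t)-1|=0$. *)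

(* Defs.v *)
From HB Require Import structures.
From mathcomp Require Import all_boot all_order all_algebra finmap.
From mathcomp Require Import all_classical all_reals all_analysis.

Set Implicit Arguments.
Unset Strict Implicit.
Unset Printing Implicit Defensive.

Import Order.TTheory GRing.Theory Num.Theory.
Import numFieldTopology.Exports numFieldNormedType.Exports.

Local Open Scope classical_set_scope.
Local Open Scope ring_scope.

(* R^d with its Borel sigma-algebra. *)
HB.instance Definition _ (R : realType) (m n : nat) :=
  Measurable.copy 'M[R]_(m, n) (g_sigma_algebraType (@open 'M[R]_(m, n))).

Section sets.
Context {R : realType} {d : nat}.
Implicit Types (A L : set 'rV[R]_d) (v : 'rV[R]_d).

Definition nonneg_vec v := forall k, 0 <= v 0 k.

Definition scale_set (x : R) A : set 'rV[R]_d := [set x *: a | a in A].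

Definition increasing_set A := forall x y, A x -> nonneg_vec y -> A (x + y).

Definition decreasing_set L := increasing_set [set - y | y in L].

Definition boundary L := closure L `\` L^°.

(* The family written as a script R in the literature on multivariate
   subexponentiality. *)
Definition scrR A :=
  [/\ A != setT, open A, increasing_set A, convex_set (~` A)
    & ~ closure A 0].

Definition ruin_set L :=
  [/\ open L, decreasing_set L, convex_set (~` L), boundary L 0
    & forall x : R, 0 < x -> scale_set x L = L].

Definition minus_set (l : 'rV[R]_d) L : set 'rV[R]_d := [set l - y | y in L].

Lemma minus_setE (l : 'rV[R]_d) L :
  minus_set l L = (fun a => l - a) @^-1` L.
Proof.
apply/seteqP; split=> [_ [y Ly <-]|a La] /=; first by rewrite subKr.
by exists (l - a) => //; rewrite subKr.
Qed.

Lemma ruin_set_scrR (l : 'rV[R]_d) L :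
  (forall k, 0 < l 0 k) -> ruin_set L -> scrR (minus_set l L).
Proof.
move=> l0 [oL dL cL [_ bL0] _].
have L0 : ~ L 0 by move=> L0; apply: bL0; rewrite (interior_id L).1.
have decL y v : L y -> nonneg_vec v -> L (y - v).
  move=> Ly v0.
  have [|z Lz zE] := dL (- y) v _ v0; first by exists y.
  by rewrite -[y - v]opprK opprB addrC -zE opprK.
have nAl (a : 'rV[R]_d) : (forall k, a 0 k < l 0 k) -> ~ minus_set l L a.
  rewrite minus_setE => al /decL La; apply: L0.
  rewrite -(subrr (l - a)); apply: La => k.
  by rewrite !mxE subr_ge0 ltW.
split.
- apply/eqP => AT; apply: (nAl 0) => [k|]; first by rewrite mxE.
  by rewrite AT.
- rewrite minus_setE; apply: open_comp => // a _.
  by apply: continuousB; [exact: cst_continuous|exact: cvg_id].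
- rewrite minus_setE => x y /= Lx y0.
  by rewrite opprD addrA; exact: decL.
- rewrite minus_setE => x y k; rewrite !inE /= => nx ny.
  have := cL (l - x) (l - y) k; rewrite !inE /= => /(_ nx ny).
  congr (~ L _).
  transitivity (k%:num *: (l - x) + (1 - k%:num) *: (l - y)) => //.
  rewrite !scalerBr addrACA -opprD -scalerDl.
  by rewrite [k%:num + _]addrC subrK scale1r.
- move=> /(_ [set a : 'rV[R]_d | forall k, a 0 k < l 0 k])[].
    apply: (@filter_forall _ _ (fun k (a : 'rV[R]_d) => a 0 k < l 0 k) (nbhs (0 : 'rV[R]_d)) _) => k.
    have : (fun a : 'rV[R]_d => a 0 k) @ (0 : 'rV[R]_d) --> (0 : 'rV[R]_d) 0 k.
      exact: coord_continuous.
    by rewrite mxE => /(_ [set r | r < l 0 k]); apply; exact: lt_nbhsl.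
  by move=> a [Aa al]; exact: (nAl a).
Qed.

(* For A in scrR and v >= 0 the set below is bounded above and contains no
   u < 0; when it is empty, [sup] is 0, so that Y_ A v >= 0. *)
Definition Y_ A v : R := sup [set u : R | scale_set u A v].

End sets.

Section distribution_classes.
Context {R : realType}.

(* [V] is the law of a real random variable. *)
Implicit Type V : set (measurableTypeR R) -> \bar R.

Definition tail V (x : R) : R := fine (V `]x, +oo[%classic).

Definition infinite_endpoint V := forall x, 0 < tail V x.

Definition class_L V := infinite_endpoint V /\
  forall a : R, 0 < a -> tail V (x - a) / tail V x @[x --> +oo] --> (1 : R).

Definition class_D V := infinite_endpoint V /\
  forall b : R, 0 < b < 1 ->
    (limf_esup (fun x : R => (tail V (b * x) / tail V x)%:E) +oo%R < +oo)%E.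

Definition law_on {d : nat} (F : probability 'rV[R]_d R) (A : set 'rV[R]_d) :
    set (measurableTypeR R) -> \bar R :=
  pushforward F (Y_ A : _ -> measurableTypeR R).

Definition class_DL_on {d : nat} (A : set 'rV[R]_d)
    (F : probability 'rV[R]_d R) :=
  class_D (law_on F A) /\ class_L (law_on F A).

(* lim_(x -> oo) sup_(t in D) |f(x;t) / g(x;t) - 1| = 0, the supremum being
   taken in [0, +oo] (so it is 0 when D is empty). *)
Definition uniformly_equivalent (D : set R) (f g : R -> R -> R) :=
  ereal_sup ([set `|f x t / g x t - 1|%:E | t in D] `|` [set 0%E])
    @[x --> +oo] --> (0%E : \bar R).

End distribution_classes.

Section probability.
Context {R : realType} {dT : measure_display} {T : measurableType dT}.
Variable P : probability T R.

Definition sigma_of {I : Type} {dU : measure_display} {U : measurableType dU}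
    (D : set I) (Y : I -> T -> U) : set (set T) :=
  <<s \bigcup_(i in D) preimage_set_system setT (Y i) measurable >>.

Definition mutually_independent {I : choiceType} (G : I -> set (set T)) :=
  forall (J : {fset I}) (E : I -> set T),
    (forall i, i \in J -> G i (E i)) ->
    P (\bigcap_(i in [set` J]) E i) = (\prod_(i <- J) P (E i))%E.

Definition mutually_independent_seq (Gs : seq (set (set T))) :=
  mutually_independent (fun i : 'I_(size Gs) => nth set0 Gs i).

Definition has_law {dU : measure_display} {U : measurableType dU}
    (Y : T -> U) (F : set U -> \bar R) :=
  forall B, measurable B -> P (Y @^-1` B) = F B.

Definition tail_asymptotically_independent (Y1 Y2 : T -> R) :=
  (fine (P ([set w | p.1 < Y1 w] `&` [set w | p.2 < Y2 w]))
     / fine (P [set w | p.2 < Y2 w]))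
  @[p --> filter_prod (pinfty_nbhs R) (pinfty_nbhs R)] --> (0 : R).

(* [tau n] is the n-th arrival time; [N t] is the number of n >= 1 with
   tau n <= t, in particular it is finite. *)
Definition renewal_counting_process
    (tau : nat -> {RV P >-> R}) (N : R -> T -> nat) :=
  let theta n : T -> R := fun w => tau n.+1 w - tau n w in
  [/\ forall w, tau 0%N w = 0,
      forall n w, 0 <= theta n w,
      mutually_independent (fun n => sigma_of [set n] theta)
    , forall n, has_law (theta n) (pushforward P (theta 0%N))
    & forall n t w, (0 < n)%N -> (n <= N t w)%N = (tau n w <= t)].

(* [lam t] is E[N(t)], assumed finite. The type [cumulative R R] bundles lam
   with its monotonicity and right-continuity, which always hold for a finite
   renewal function; it makes the measure lam(ds) available. As N t = 0 for
   t < 0, this measure puts mass lam 0 at 0. *)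
Definition renewal_function (N : R -> T -> nat) (lam : cumulative R R) :=
  forall t, ('E_P[fun w => (N t w)%:R])%E = (lam t)%:E.

End probability.

Definition cadlag {R : realType} (f : R -> R) :=
  (forall t, 0 <= t -> f s @[s --> t^'+] --> f t) /\
  (forall t, 0 < t -> cvg (f s @[s --> t^'-])).

Section risk_model.
Context {R : realType} {dT : measure_display} {T : measurableType dT}.
Context {P : probability T R} {d : nat}.
Variables (X : nat -> T -> 'rV[R]_d) (tau : nat -> T -> R).
Variables (N : R -> T -> nat) (xi : R -> T -> R) (c : R -> T -> 'rV[R]_d).
Variables (l : 'rV[R]_d).

(* Claims are numbered from 0: [X i] is the claim arriving at [tau i.+1]. *)
Definition discounted_surplus (x t : R) (w : T) : 'rV[R]_d :=
  x *: l
  + \row_k (\int[lebesgue_measure]_(s in `[0, t]) (expR (- xi s w) * c s w 0 k))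
  - \sum_(i < N t w) expR (- xi (tau i.+1 w) w) *: X i w.

Definition ruin_event (L : set 'rV[R]_d) (x t : R) : set T :=
  [set w | exists2 s, s \in `]0, t] & L (discounted_surplus x s w)].

End risk_model.

(* Main.v *)
Require Import Defs.
From HB Require Import structures.
From mathcomp Require Import all_boot all_order all_algebra finmap.
From mathcomp Require Import all_classical all_reals all_analysis.
From mathcomp Require Import measurable_realfun ring lra.

(** The functional [Y_ A] is the Minkowski functional of the complement of [A],
    a convex neighbourhood of the origin; it is sublinear, and monotone as [A]
    is increasing. Since [L] is a cone, the surplus is in [L] exactly when the
    net losses are in [x A]. Ruin before [t] therefore implies that the total
    [sum_(i < N t) D i * Y i] of the discounted sizes exceeds [x], where
    [D i = expR (- xi (tau i.+1))] and [Y i = Y_ A (X i)]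
    ([ruin_total_claims]). Conversely, the discounted premiums being bounded up
    to the horizon, ruin occurs as soon as one of the [D i * Y i] exceeds
    [x + K] for a constant [K] ([large_claim_ruin]).

    Write [Psi x t] for the right-hand side of the equivalence and [G] for the
    tail of [Y]. Freezing the arrival time, which is independent of the claims
    and of the return process, shows that [Psi x t] is also the expected number
    of claims arriving before [t] with [D i * Y i > x] ([big_claim_series]); the
    renewal measure is the sum of the laws of the arrival times
    ([renewal_measureE]). It remains to prove that, up to errors small with
    respect to [Psi x t], the total exceeds [x] because a single term does, and
    that at most one term does. As [xi <= C2] almost surely, [Psi x t] is at
    least [G (expR C2 * x) * lam t] ([tail_integral_ge]), so every error has to
    be compared with [G x * lam t], uniformly in [t].

    - More than [m] claims. By dominated variation, [G (x / n)] is at most a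
      power of [n] times [G x] ([tail_dilation]), while the probability of [n]
      arrivals before [t] is at most [lam t] times an exponentially small
      factor ([arrival_exp_decay]). The latter bound follows from the
      independence of the interarrival times: if the indices
      are cut into sufficiently many blocks, one block contains only small
      interarrival times. Hence the contribution of [n > m] is negligible for
      [m] large ([many_claims_negligible]).

    - At most [m] claims. If no term exceeds [x - h] but the sum exceeds [x],
      then some term exceeds [x / m] and another one [h / m]
      ([sum_gt_cases]). For [h] large, this is negligible by tail asymptotic
      independence ([two_large_claims]). This leads to the upper bound
      [large_total_le] by the expected number of terms above [x - h], and
      similarly, by Bonferroni's inequality, to the lower bound
      [jump_series_le] by the expected number of terms above [x + K].

    - Finally, long-tailedness makes [Psi (x - h) t], [Psi x t] and
      [Psi (x + K) t] equivalent ([tail_integral_shift]), because the return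
      process is bounded on both sides.

    The ruin event is measurable since the surplus is right-continuous and [L]
    is open, so that ruin is detected at rational times or at [t]
    ([measurable_hitting]). *)

Set Implicit Arguments.
Unset Strict Implicit.
Unset Printing Implicit Defensive.

Import Order.TTheory GRing.Theory Num.Theory.
Import numFieldTopology.Exports numFieldNormedType.Exports.

Local Open Scope classical_set_scope.
Local Open Scope ring_scope.

(** * The Minkowski functional of the complement of an increasing set *)

Section gauge.
Context {R : realType} {d : nat} (A : set 'rV[R]_d).
Hypothesis hA : scrR A.
Implicit Types (u x : R) (v w : 'rV[R]_d).

Lemma scale_setP (B : set 'rV[R]_d) u v : 0 < u ->
  scale_set u B v <-> B (u^-1 *: v).
Proof.
move=> u0; split=> [[a Ba <-]|Bv].
  by rewrite scalerA mulVf ?gt_eqF// scale1r.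
by exists (u^-1 *: v) => //; rewrite scalerA mulfV ?gt_eqF// scale1r.
Qed.

Let oA : open A. Proof. by case: hA. Qed.

Let scaler_cont v (s : R) : (fun r : R => r *: v) @ s --> s *: v.
Proof. by apply: cvgZr_tmp; exact: cvg_id. Qed.

Lemma scrR_not0 : ~ A 0.
Proof. by case: hA => _ _ _ _ cA A0; apply: cA; exact: subset_closure. Qed.

(** Convexity of the complement of [A]: a vector outside [u A] plus a vector
    outside [x A] is outside [(u + x) A]. *)
Lemma scale_setD u x v w : 0 < u -> 0 < x ->
  scale_set (u + x) A (v + w) -> scale_set u A v \/ scale_set x A w.
Proof.
move=> u0 x0; have ux0 := addr_gt0 u0 x0.
rewrite !scale_setP//; case: hA => _ _ _ cA _ Avw.
apply: contrapT => /not_orP[nv nw].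
have k01 : 0 <= u / (u + x) <= 1.
  by rewrite divr_ge0 ?(ltW u0) ?(ltW ux0)//= ler_pdivrMr// mul1r lerDl ltW.
have [k0 k1] := andP k01.
have := cA (u^-1 *: v) (x^-1 *: w) (Itv01 k0 k1).
rewrite !inE /= => /(_ nv nw); apply.
rewrite [X in A X](_ : _ = (u + x)^-1 *: (v + w))//.
transitivity ((u / (u + x)) *: (u^-1 *: v) + (1 - u / (u + x)) *: (x^-1 *: w)) => //.
rewrite scalerDr !scalerA; congr (_ *: _ + _ *: _); field.
  by rewrite !gt_eqF.
by rewrite !gt_eqF.
Qed.

Lemma scale_set_le u x v : 0 < u -> u <= x ->
  scale_set x A v -> scale_set u A v.
Proof.
move=> u0; rewrite le_eqVlt => /predU1P[->//|ux xAv].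
have xu0 : 0 < x - u by rewrite subr_gt0.
have := @scale_setD u (x - u) v 0 u0 xu0; rewrite addr0 subrKC => /(_ xAv)[//|].
by rewrite scale_setP// scaler0 => /scrR_not0.
Qed.

Lemma scale_set_increasing u v w : 0 < u -> nonneg_vec w ->
  scale_set u A v -> scale_set u A (v + w).
Proof.
move=> u0 w0; rewrite !scale_setP// scalerDr => Av.
case: hA => _ _ + _ _; apply=> // k.
by rewrite mxE mulr_ge0// invr_ge0 ltW.
Qed.

(** The complement of [A] is a neighbourhood of the origin, hence absorbing. *)
Lemma scale_set_bounded v : exists2 u, 0 < u & ~ scale_set u A v.
Proof.
case: hA => _ _ _ _; rewrite /closure => /existsNP[B /not_implyP[B0 nAB]].
have : \forall s \near (0 : R), B (s *: v).
  by have := @scaler_cont v 0; rewrite scale0r; apply.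
move=> [e /= e0 eB].
have e20 : 0 < (e / 2)^-1 by rewrite invr_gt0 divr_gt0.
exists ((e / 2)^-1) => //; rewrite scale_setP// invrK => Av.
apply: nAB; exists (e / 2 *: v); split => //; apply: eB => /=.
by rewrite sub0r normrN gtr0_norm ?divr_gt0// ltr_pdivrMr// ltr_pMr// ltr1n.
Qed.

(** As [A] is open, a positive supremum in the definition of [Y_] is not
    attained. *)
Lemma scale_set_lt u v : 0 < u -> scale_set u A v ->
  exists2 x, u < x & scale_set x A v.
Proof.
move=> u0; rewrite scale_setP// => Av.
have : \forall s \near u^-1, A (s *: v).
  by apply: (@scaler_cont v); exact: open_nbhs_nbhs.
move=> [e /= e0 eA].
pose s := Num.max (u^-1 / 2) (u^-1 - e / 2).
have us : s < u^-1.
  by rewrite gt_max ltr_pdivrMr// ltr_pMr ?invr_gt0// ltr1n/= ltrBlDr ltrDl divr_gt0.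
have s0 : 0 < s by rewrite lt_max divr_gt0 ?invr_gt0.
exists s^-1; first by rewrite -[ltLHS]invrK ltf_pV2// posrE invr_gt0.
rewrite scale_setP ?invr_gt0// invrK; apply: eA => /=.
rewrite gtr0_norm ?subr_gt0// ltrBlDr -ltrBlDl (lt_le_trans (_ : _ < u^-1 - e / 2))//.
  by rewrite ltrD2l ltrN2 ltr_pdivrMr// ltr_pMr// ltr1n.
by rewrite le_max lexx orbT.
Qed.

Let Yset v := [set u | scale_set u A v].

Let Yset_ub v : has_ubound (Yset v).
Proof.
have [x x0 xAv] := scale_set_bounded v.
exists x => u uAv; rewrite leNgt; apply/negP => xu.
by apply: xAv; apply: scale_set_le uAv => //; exact: ltW.
Qed.

(** [Y_ A] is the Minkowski functional of the convex neighbourhood [~` A] of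
    the origin, so that membership in the dilations of [A] is a comparison
    with a real number. *)
Lemma lt_gaugeP u v : 0 < u -> u < Y_ A v <-> scale_set u A v.
Proof.
move=> u0; split=> [|uAv]; last first.
  have [x ux xAv] := scale_set_lt u0 uAv.
  by rewrite (lt_le_trans ux)//; exact: (ub_le_sup (Yset_ub v)).
have [YE|/set0P Yv0 uY] := eqVneq (Yset v) set0.
  by rewrite /Y_ -/(Yset v) YE sup0 ltNge ltW.
have [x xAv ux] := sup_gt Yv0 uY.
by apply: scale_set_le xAv => //; exact: ltW.
Qed.

Lemma gauge_ge0 v : nonneg_vec v -> 0 <= Y_ A v.
Proof.
move=> v0; have [YE|/set0P[u uAv]] := eqVneq (Yset v) set0.
  by rewrite /Y_ -/(Yset v) YE sup0.
suff u0 : 0 <= u by rewrite (le_trans u0)//; exact: (ub_le_sup (Yset_ub v)).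
rewrite leNgt; apply/negP => u0; case: uAv => a Aa uav.
have := scrR_not0; apply; rewrite -(subrr a).
case: hA => _ _ + _ _; apply=> // k.
have := v0 k; rewrite -uav !mxE oppr_ge0.
by rewrite nmulr_rge0.
Qed.

Lemma gauge_le v x : 0 <= x -> (forall u, x < u -> ~ scale_set u A v) ->
  Y_ A v <= x.
Proof.
move=> x0 nA; rewrite leNgt; apply/negP => /midf_lt[xu uY].
by apply: (nA _ xu); apply/lt_gaugeP => //; exact: le_lt_trans xu.
Qed.

(** With homogeneity, this reduces sums of claim vectors to sums of real
    random variables. *)
Lemma gauge_subadd v w : nonneg_vec v -> nonneg_vec w ->
  Y_ A (v + w) <= Y_ A v + Y_ A w.
Proof.
move=> v0 w0; have [Yv Yw] := (gauge_ge0 v0, gauge_ge0 w0).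
apply: gauge_le => [|u]; first exact: addr_ge0.
rewrite -subr_gt0 => Yu uA; pose e := (u - (Y_ A v + Y_ A w)) / 2.
have e0 : 0 < e by rewrite divr_gt0.
have uE : u = (Y_ A v + e) + (Y_ A w + e).
  by rewrite addrACA /e -splitr subrKC.
move: uA; rewrite uE => /scale_setD-/(_ (ltr_wpDl Yv e0) (ltr_wpDl Yw e0))[].
  by move=> /(lt_gaugeP _ (ltr_wpDl Yv e0)); rewrite gtrDl ltNge ltW.
by move=> /(lt_gaugeP _ (ltr_wpDl Yw e0)); rewrite gtrDl ltNge ltW.
Qed.

Lemma scale_setZ u x v : 0 < u -> 0 < x ->
  scale_set u A (x *: v) <-> u < x * Y_ A v.
Proof.
move=> u0 x0; rewrite -ltr_pdivrMl// mulrC lt_gaugeP ?divr_gt0//.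
by rewrite !scale_setP ?divr_gt0// scalerA invf_div mulrC.
Qed.

Lemma gaugeZ x v : 0 < x -> nonneg_vec v -> Y_ A (x *: v) <= x * Y_ A v.
Proof.
move=> x0 v0; have Yv := mulr_ge0 (ltW x0) (gauge_ge0 v0).
apply: gauge_le => // u Yu; rewrite scale_setZ//; last exact: le_lt_trans Yu.
by apply/negP; rewrite -leNgt ltW.
Qed.

Lemma gauge_sum n (a : 'I_n -> R) (v : 'I_n -> 'rV[R]_d) :
  (forall i, 0 < a i) -> (forall i, nonneg_vec (v i)) ->
  Y_ A (\sum_(i < n) a i *: v i) <= \sum_(i < n) a i * Y_ A (v i).
Proof.
move=> a0 v0.
suff [] : nonneg_vec (\sum_(i < n) a i *: v i) /\
    Y_ A (\sum_(i < n) a i *: v i) <= \sum_(i < n) a i * Y_ A (v i) by [].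
elim/big_rec2 : _ => [|i y w _ [w0 wy]].
  split=> [k|]; first by rewrite mxE.
  by apply: gauge_le => // u u0; rewrite scale_setP// scaler0; exact: scrR_not0.
have av0 : nonneg_vec (a i *: v i) by move=> k; rewrite mxE mulr_ge0 ?(ltW (a0 i))//; exact: v0.
split=> [k|]; first by rewrite mxE addr_ge0 ?av0 ?w0.
by rewrite (le_trans (gauge_subadd av0 w0))// lerD// gaugeZ.
Qed.

End gauge.

(** * Measurability of comparisons and of increasing sets *)

Section measurable_comparison.
Context {R : realType} {dT : measure_display} {T : measurableType dT}.
Variables f g : T -> R.
Hypotheses (mf : measurable_fun setT f) (mg : measurable_fun setT g).

Let measurable_true (b : T -> bool) : measurable_fun setT b -> measurable [set w | b w].
Proof. by move=> /(_ measurableT [set true] I); rewrite setTI. Qed.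

Lemma measurable_ler : measurable [set w | f w <= g w].
Proof. exact/measurable_true/measurable_fun_ler. Qed.

Lemma measurable_ltr : measurable [set w | f w < g w].
Proof. exact/measurable_true/measurable_fun_ltr. Qed.

End measurable_comparison.

(** An open increasing set is a countable union of the orthants
    [q + [0, oo)^d] with [q] rational in it. *)
Lemma measurable_preimage_increasing {R : realType} {d : nat}
    {dT : measure_display} {T : measurableType dT} (A : set 'rV[R]_d)
    (V : T -> 'rV[R]_d) :
  open A -> increasing_set A -> (forall k, measurable_fun setT (fun w => V w 0 k)) ->
  measurable (V @^-1` A).
Proof.
move=> oA iA mV.
have -> : V @^-1` A = \bigcup_(q : 'rV[rat]_d)
    (if `[< A (map_mx ratr q) >] then
       \bigcap_(k in [set: 'I_d]) [set w | ratr (q 0 k) <= V w 0 k] else set0).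
  apply/seteqP; split=> [w /= AV|w [q _]]; last first.
    case: ifPn => // /asboolP Aq /= qV.
    rewrite -(subrKC (map_mx ratr q) (V w)); apply: iA => // k.
    by rewrite !mxE subr_ge0; exact: qV.
  have /nbhs_ballP[e /= e0 eA] : nbhs (V w) A by exact: open_nbhs_nbhs.
  have qP k : exists q : rat, V w 0 k - e < ratr q < V w 0 k.
    have [|q] := @rat_in_itvoo _ (V w 0 k - e) (V w 0 k); first by rewrite ltrBlDr ltrDl.
    by rewrite in_itv; exists q.
  exists (\row_k xchoose (qP k)) => //.
  case: ifPn => [_ k _ /=|/asboolPn[]].
    by rewrite mxE; have /andP[_ /ltW] := xchooseP (qP k).
  apply: eA; split=> // i j; rewrite !mxE (ord1 i) /ball /=.
  have /andP[q1 q2] := xchooseP (qP j).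
  by rewrite gtr0_norm ?subr_gt0// ltrBlDr -ltrBlDl.
apply: countable_bigcupT_measurable; first exact: countableP.
move=> q; case: ifPn => // _.
apply: fin_bigcap_measurable; first exact: finite_finset.
by move=> k _; exact: measurable_ler.
Qed.

Lemma measurable_coord {R : realType} {d : nat} (k : 'I_d) :
  measurable_fun setT (fun v : 'rV[R]_d => v 0 k).
Proof.
apply: (measurability _ (RGenOInfty.measurableE R)) => //.
move=> _ [_ [a ->] <-]; rewrite setTI; apply: sub_sigma_algebra.
by apply: open_comp => // v _; exact: coord_continuous.
Qed.

Lemma open_scale_set {R : realType} {d : nat} (A : set 'rV[R]_d) (u : R) :
  0 < u -> open A -> open (scale_set u A).
Proof.
move=> u0 oA; rewrite (_ : scale_set u A = (fun v => u^-1 *: v) @^-1` A).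
  by apply: open_comp => // v _; exact: scaler_continuous.
by apply/funext => v; apply/propext; exact: scale_setP.
Qed.

(** * Independent sigma-algebras *)

Section independence.
Context {R : realType} {dT : measure_display} {T : measurableType dT}.
Variable P : probability T R.

(** Disintegration of the probability of an event along two independent
    random elements: freeze the first one, then average over it. *)
Lemma probability_indep_prod {d1 d2} {S1 : measurableType d1}
    {S2 : measurableType d2} (U : T -> S1) (V : T -> S2) (E : set (S1 * S2)) :
  measurable_fun setT U -> measurable_fun setT V ->
  (forall A B, measurable A -> measurable B ->
    P (U @^-1` A `&` V @^-1` B) = (P (U @^-1` A) * P (V @^-1` B))%E) ->
  measurable E ->
  P [set w | E (U w, V w)] = (\int[P]_w P [set w' | E (U w, V w')])%E.
Proof.
move=> mU mV UV mE.
have mUV : measurable_fun setT (fun w => (U w, V w)) by exact: measurable_fun_pair.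
pose U' : {RV P >-> S1} := HB.pack U (isMeasurableFun.Build _ _ _ _ _ mU).
pose V' : {RV P >-> S2} := HB.pack V (isMeasurableFun.Build _ _ _ _ _ mV).
pose UV' : {RV P >-> (S1 * S2)%type} :=
  HB.pack (fun w => (U w, V w)) (isMeasurableFun.Build _ _ _ _ _ mUV).
have := @product_measure_unique _ _ _ _ _ (distribution P U') (distribution P V')
  (distribution P UV') UV E mE.
rewrite /product_measure1 ge0_integral_distribution//; last exact: measurable_fun_xsection.
move=> UVE; rewrite [LHS](_ : _ = distribution P UV' E)// -UVE.
apply: eq_integral => w _; rewrite /distribution /pushforward /=.
by congr (P _); apply/seteqP; split => w' /=; rewrite /xsection /= inE.
Qed.

(** The finite measures [P (C `&` _)] and [P C * P _] agree on the sigma-algebra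
    generated by a pi-system as soon as they agree on the latter. *)
Lemma indep_sigma (C : set T) (G : set (set T)) :
  measurable C -> G `<=` measurable -> setI_closed G -> G setT ->
  (forall B, G B -> P (C `&` B) = (P C * P B)%E) ->
  forall B, <<s G >> B -> P (C `&` B) = (P C * P B)%E.
Proof.
move=> mC mG GI GT CG B GB.
have PC : P C = (fine (P C))%:E by rewrite fineK// fin_num_measure.
have PC0 : 0 <= fine (P C) by rewrite fine_ge0.
pose m1 : {measure set T -> \bar R} := mrestr P mC.
pose m2 : {measure set T -> \bar R} := mscale (NngNum PC0) P.
have m1E D : m1 D = P (C `&` D) by rewrite /m1 /= /mrestr setIC.
have m2E D : m2 D = (P C * P D)%E by rewrite /m2 /= /mscale /= -PC.
rewrite -m1E -m2E; apply: (g_sigma_algebra_measure_unique G mG (fun=> setT)) => //.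
- by apply/seteqP; split=> // w _; exists 0%N.
- by move=> D GD; rewrite m1E m2E CG.
- by move=> _; rewrite m1E setIT -ge0_fin_numE// fin_num_measure.
Qed.

Lemma sub_sigma_of {I : Type} {dU : measure_display} {U : measurableType dU}
    (D : set I) (Y : I -> T -> U) (H : set (set T)) :
  sigma_algebra setT H ->
  (forall i, D i -> forall B, measurable B -> H (Y i @^-1` B)) ->
  sigma_of D Y `<=` H.
Proof.
move=> sH YH; apply: smallest_sub => // _ [i Di [B mB <-]].
by rewrite setTI; exact: YH.
Qed.

Lemma sigma_of_preimage {I : Type} {dU : measure_display} {U : measurableType dU}
    (D : set I) (Y : I -> T -> U) i B :
  D i -> measurable B -> sigma_of D Y (Y i @^-1` B).
Proof.
move=> Di mB; apply: sub_sigma_algebra; exists i => //; exists B => //.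
by rewrite setTI.
Qed.

Lemma sigma_of_measurable {I : Type} {dU : measure_display} {U : measurableType dU}
    (D : set I) (Y : I -> T -> U) :
  (forall i, D i -> measurable_fun setT (Y i)) -> sigma_of D Y `<=` measurable.
Proof.
move=> mY; apply: sub_sigma_of => [|i Di B mB]; first exact: sigma_algebra_measurable.
by rewrite -[X in measurable X]setTI; exact: mY.
Qed.

Lemma sigma_ofT {I : Type} {dU : measure_display} {U : measurableType dU}
    (D : set I) (Y : I -> T -> U) : sigma_of D Y setT.
Proof.
have [s0 sC _] := @smallest_sigma_algebra T setT
  (\bigcup_(i in D) preimage_set_system setT (Y i) measurable).
by rewrite -(setD0 setT); exact: sC.
Qed.

Lemma sigma_of_setI {I : Type} {dU : measure_display} {U : measurableType dU}
    (D : set I) (Y : I -> T -> U) : setI_closed (sigma_of D Y).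
Proof.
have /sigma_algebraP[//|_ _ _] := @smallest_sigma_algebra T setT
  (\bigcup_(i in D) preimage_set_system setT (Y i) measurable).
exact.
Qed.

Lemma mutually_independent_bigcap {I : choiceType} (G : I -> set (set T))
    (s : seq I) (E : I -> set T) :
  mutually_independent P G -> uniq s -> (forall i, i \in s -> G i (E i)) ->
  P (\big[setI/setT]_(i <- s) E i) = (\prod_(i <- s) P (E i))%E.
Proof.
move=> ind us EG; pose J := [fset i | i in s]%fset.
have sJ : perm_eq J s.
  by apply: uniq_perm => // i; rewrite !inE.
rewrite -!(perm_big _ sJ) -bigcap_fset; apply: ind => i.
by rewrite !inE; exact: EG.
Qed.

(** The fourth event is taken to be the whole space. *)
Lemma indep_seq4 (G0 G1 G2 G3 : set (set T)) E0 E1 E2 : G3 setT ->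
  mutually_independent_seq P [:: G0; G1; G2; G3] ->
  G0 E0 -> G1 E1 -> G2 E2 ->
  P (E0 `&` E1 `&` E2) = (P E0 * P E1 * P E2)%E.
Proof.
move=> G3T ind g0 g1 g2.
pose E (i : 'I_4) := nth setT [:: E0; E1; E2; setT] i.
have := mutually_independent_bigcap (E := E) ind (index_enum_uniq 'I_4).
rewrite !big_ord_recr !big_ord0 /= setTI setIT mul1e probability_setT mule1.
by apply; case=> -[|[|[|[|]]]].
Qed.

Lemma indep_seq2 (G0 G1 : set (set T)) E0 E1 :
  mutually_independent_seq P [:: G0; G1] -> G0 E0 -> G1 E1 ->
  P (E0 `&` E1) = (P E0 * P E1)%E.
Proof.
move=> ind g0 g1; pose E (i : 'I_2) := nth setT [:: E0; E1] i.
have := mutually_independent_bigcap (E := E) ind (index_enum_uniq 'I_2).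
rewrite !big_ord_recr !big_ord0 /= setTI mul1e.
by apply; case=> -[|[|]].
Qed.

End independence.

(** * Measurability along right-continuous paths *)

Section random_index.
Context {d1 d2 : measure_display} {S : measurableType d1} {U : measurableType d2}.

Lemma measurable_fun_nat_index (K : S -> nat) (h : nat -> S -> U) :
  (forall k, measurable (K @^-1` [set k])) ->
  (forall k, measurable_fun setT (h k)) ->
  measurable_fun setT (fun w => h (K w) w).
Proof.
move=> mK mh _ B mB.
rewrite [X in measurable X](_ : _ =
    \bigcup_k (K @^-1` [set k] `&` (setT `&` h k @^-1` B))); last first.
  apply/seteqP; split=> [w [_ Bw]|w [k _ [/= <- [_ Bw]]]//].
  by exists (K w).
by apply: bigcup_measurable => k _; apply: measurableI => //; exact: mh.
Qed.

End random_index.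

Section cadlag_paths.
Context {R : realType}.

(** One-sided limits make the path bounded near each point of the compact
    interval. *)
Lemma cadlag_bounded (f : R -> R) (S : R) : cadlag f ->
  exists M, forall t, 0 <= t <= S -> `|f t| <= M.
Proof.
move=> [fr fl].
have /compact_near_coveringP/(_ R +oo%R (fun M t => 0 <= t -> `|f t| <= M)) :=
  @segment_compact R 0 S.
case.
- move=> t /=; rewrite in_itv => /andP[t0 _].
  have [M1 tM1] : exists M1, \forall s \near t^'+, `|f s| <= M1.
    exists (`|f t| + 1); have /cvgrPdist_le /(_ 1 ltr01) := fr _ t0.
    apply: filterS => s; rewrite distrC => fst.
    by rewrite -(subrK (f t) (f s)) (le_trans (ler_normD _ _))// addrC lerD2l.
  have [M2 tM2] : exists M2, \forall s \near t^'-, 0 <= s -> `|f s| <= M2.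
    have [t0'|t0'] := ltP 0 t; last first.
      exists 0; near=> s => s0; have st : s < t by near: s; exact: nbhs_left_lt.
      by have := le_lt_trans s0 (lt_le_trans st t0'); rewrite ltxx.
    exists (`|lim (f s @[s --> t^'-])| + 1).
    have /cvgrPdist_le /(_ 1 ltr01) := fl _ t0'.
    apply: filterS => s; rewrite distrC => fst _.
    set L := lim _ in fst *.
    by rewrite -(subrK L (f s)) (le_trans (ler_normD _ _))// addrC lerD2l.
  have tM : \forall s \near t, 0 <= s -> `|f s| <= Num.max `|f t| (Num.max M1 M2).
    move: tM1 tM2; rewrite /at_right /at_left !near_withinE => tM1 tM2.
    apply: filterS2 tM1 tM2 => s h1 h2 s0.
    rewrite !le_max; case: (ltgtP t s) => [/h1->|/h2->|<-]; rewrite ?orbT//.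
    by rewrite lexx.
  exists ([set s | 0 <= s -> `|f s| <= Num.max `|f t| (Num.max M1 M2)],
          [set M | Num.max `|f t| (Num.max M1 M2) <= M]) => /=.
    by split => //; apply: nbhs_pinfty_ge; exact: num_real.
  by move=> [s M] [/= sM MM] /sM /le_trans; exact.
- move=> M [_ MP]; exists (M + 1) => t t0S.
  by apply: (MP (M + 1)); rewrite ?ltrDl//=; case/andP: t0S.
Unshelve. all: by end_near. Qed.

(** Approximation of [s] by a grid of mesh [1 / n.+1] from the right, so that a
    right-continuous path is the limit of its values on the grids. *)
Let grid (n : nat) (s : R) : R := (Num.truncn (s * n.+1%:R)).+1%:R / n.+1%:R.

Let grid_gt n s : 0 <= s -> s < grid n s.
Proof.
move=> s0; rewrite /grid ltr_pdivlMr//.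
by have /andP[] := truncn_itv (mulr_ge0 s0 (ler0n R n.+1)).
Qed.

Let grid_le n s : 0 <= s -> grid n s <= s + n.+1%:R^-1.
Proof.
move=> s0; rewrite /grid ler_pdivrMr// mulrDl mulVf// -natr1 lerD2r.
by have /andP[] := truncn_itv (mulr_ge0 s0 (ler0n R n.+1)).
Qed.

(** Times are truncated at [0] because nothing is assumed of the process at
    negative times. *)
Lemma measurable_right_continuous {d : measure_display} {S : measurableType d}
    (f : R -> S -> R) :
  (forall s, 0 <= s -> measurable_fun setT (f s)) ->
  (forall w s, 0 <= s -> f r w @[r --> s^'+] --> f s w) ->
  measurable_fun setT (fun p : measurableTypeR R * S => f (Num.max 0 p.1) p.2).
Proof.
move=> mf cf.
pose h n (p : measurableTypeR R * S) := f (grid n (Num.max 0 p.1)) p.2.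
apply: (@measurable_fun_cvg _ _ _ setT h).
- move=> n; pose K (p : measurableTypeR R * S) := Num.truncn (Num.max 0 p.1 * n.+1%:R).
  apply: (@measurable_fun_nat_index _ _ _ _ K (fun k p => f (k.+1%:R / n.+1%:R) p.2)).
    have mg : measurable_fun setT
        (fun p : measurableTypeR R * S => Num.max 0 p.1 * n.+1%:R).
      by apply: measurable_funM => //; exact: measurable_maxr.
    move=> k; rewrite [X in measurable X](_ : _ =
        [set p : measurableTypeR R * S | k%:R <= Num.max 0 p.1 * n.+1%:R] `&`
        [set p | Num.max 0 p.1 * n.+1%:R < k.+1%:R]).
      by apply: measurableI; [apply: measurable_ler|apply: measurable_ltr].
    have p0 (p : measurableTypeR R * S) : 0 <= Num.max 0 p.1 * n.+1%:R.
      by rewrite mulr_ge0// le_max lexx.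
    apply/seteqP; split => p; rewrite /K /=.
      by move/eqP; rewrite truncn_eq// => /andP.
    by move=> [k1 k2]; apply/eqP; rewrite truncn_eq// k1.
  by move=> k; apply: measurableT_comp => //; apply: mf; rewrite divr_ge0.
- move=> [s w] _ /=; set s' := Num.max 0 s.
  have s0 : 0 <= s' by rewrite le_max lexx.
  apply/cvgrPdist_le => e e0.
  have /cvgrPdist_le /(_ e e0) := cf w s' s0.
  rewrite /at_right near_withinE => -[r /= r0 rP].
  near=> n; apply: rP => /=; last exact: grid_gt.
  rewrite distrC gtr0_norm ?subr_gt0 ?grid_gt// ltrBlDl.
  rewrite (le_lt_trans (grid_le n s0))// ltrD2l.
  by near: n; exact: near_infty_natSinv_lt (PosNum r0).
Unshelve. all: by end_near. Qed.

(** A right-continuous path that enters an open set during [(0, t]] is in it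
    at [t] or at a rational time. *)
Lemma measurable_hitting {d : measure_display} {S : measurableType d}
    (E : R -> set S) (t : R) : 0 < t ->
  (forall s, 0 <= s -> measurable (E s)) ->
  (forall s w, 0 <= s -> E s w -> \forall r \near s^'+, E r w) ->
  measurable [set w | exists2 s, s \in `]0, t] & E s w].
Proof.
move=> t0 mE oE.
have -> : [set w | exists2 s, s \in `]0, t] & E s w] = E t `|` \bigcup_(q : rat)
    (if 0 < (ratr q : R) < t then E (ratr q) else set0).
  apply/seteqP; split => w; last first.
    case=> [Et|[q _]]; first by exists t; rewrite // in_itv/= t0 lexx.
    case: ifPn => // /andP[q0 qt] Eq.
    by exists (ratr q) => //; rewrite in_itv/= q0 ltW.
  move=> [s]; rewrite in_itv/= => /andP[s0].
  rewrite le_eqVlt => /predU1P[->|st] Es; first by left.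
  right; have := oE _ _ (ltW s0) Es; rewrite /at_right near_withinE => -[e /= e0 eE].
  have [|q] := @rat_in_itvoo _ s (Num.min t (s + e)).
    by rewrite lt_min st ltrDl.
  rewrite in_itv/= lt_min => /and3P[sq qt qe]; exists q => //.
  rewrite (lt_trans s0 sq) qt /=; apply: eE => //=.
  by rewrite distrC gtr0_norm ?subr_gt0// ltrBlDl.
apply: measurableU; first exact: mE (ltW t0).
apply: countable_bigcupT_measurable; first exact: countableP.
by move=> q; case: ifPn => // /andP[q0 _]; exact: mE (ltW q0).
Qed.

End cadlag_paths.

(** * Tails of dominated variation *)

Section heavy_tail.
Context {R : realType}.

(** From [1 + y <= expR y] at [y = s * u / p], raised to the power [p]. *)
Lemma powr_le_expR (p : nat) (s : R) : 0 < s ->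
  exists2 C, 0 < C & forall u : R, 0 <= u -> u ^+ p <= C * expR (s * u).
Proof.
move=> s0; have [->|p0] := posnP p.
  exists 1 => // u u0; rewrite expr0 mul1r -expR0 ler_expR.
  by rewrite mulr_ge0// ltW.
have p0' : 0 < p%:R :> R by rewrite ltr0n.
have ps0 : 0 < p%:R / s by rewrite divr_gt0.
exists ((p%:R / s) ^+ p) => [|u u0]; first by rewrite exprn_gt0.
have -> : expR (s * u) = expR (s * u / p%:R) ^+ p.
  by rewrite -expRM_natl mulrCA mulfV ?mulr1// gt_eqF.
rewrite -exprMn ler_pXn2r// ?nnegrE//; last by rewrite mulr_ge0 ?expR_ge0// ltW.
rewrite -[leLHS](@mulVKf _ (p%:R / s)) ?gt_eqF// ler_pM2l// invf_div.
rewrite mulrAC (le_trans _ (expR_ge1Dx _))//.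
by rewrite lerDr.
Qed.

Variable G : R -> R.
Hypothesis G_gt0 : forall x, 0 < x -> 0 < G x.
Hypothesis G_le1 : forall x, 0 < x -> G x <= 1.
Hypothesis G_anti : forall x y, 0 < x -> x <= y -> G y <= G x.
Hypothesis G_dominated : exists B x0, 0 < x0 /\
  forall x, x0 <= x -> G (x / 2) <= B * G x.

(** Iterated halving stops being controlled by dominated variation once the
    argument falls below [x0]; from then on [G <= 1] is compared with the
    constant [G x0]. *)
Lemma tail_dyadic_dilation : exists B C x0, [/\ 1 <= B, 0 < C, 0 < x0 &
  forall k x, x0 <= x -> G (x / 2 ^+ k) <= C * B ^+ k * G x].
Proof.
have [B0 [x0 [x00 GB]]] := G_dominated; pose B := Num.max 1 B0.
have B1 : 1 <= B by rewrite le_max lexx.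
have B0' : 0 < B by exact: lt_le_trans B1.
have Gx0 := G_gt0 x00.
exists B, (G x0)^-1, x0; split=> //; first by rewrite invr_gt0.
elim=> [|k IH] x x0x.
  have xp : 0 < x by exact: lt_le_trans x0x.
  rewrite !expr0 divr1 mulr1 ler_peMl ?(ltW (G_gt0 xp))//.
  by rewrite invf_ge1// G_le1.
have xp : 0 < x by exact: lt_le_trans x0x.
have GBx : G (x / 2) <= B * G x.
  rewrite (le_trans (GB _ x0x))// ler_pM2r ?G_gt0// le_max lexx orbT//.
have -> : x / 2 ^+ k.+1 = x / 2 / 2 ^+ k by rewrite exprS invfM mulrA.
have [x02|x02] := leP x0 (x / 2).
  rewrite (le_trans (IH _ x02))// exprSr -mulrA -!mulrA.
  by rewrite ler_pM2l ?invr_gt0// ler_pM2l ?exprn_gt0.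
rewrite (le_trans (G_le1 _)) ?divr_gt0 ?exprn_gt0//.
rewrite -mulrA -(mulVf (lt0r_neq0 Gx0)) ler_pM2l ?invr_gt0//.
rewrite (le_trans (G_anti _ (ltW x02))) ?divr_gt0// (le_trans GBx)//.
by rewrite ler_pM2r ?G_gt0// exprS ler_peMr ?(ltW B0')// exprn_ege1.
Qed.

(** Dominated variation allows a power of [n] as growth of [G (x / n)]; any
    exponential growth, however slow, dominates it. *)
Lemma tail_dilation (s : R) : 0 < s -> exists C x0, [/\ 0 < C, 0 < x0 &
  forall n x, (0 < n)%N -> x0 <= x -> G (x / n%:R) <= C * expR (s * n%:R) * G x].
Proof.
move=> s0; have [B [C [x0 [B1 C0 x00 GB]]]] := tail_dyadic_dilation.
(* [B <= 2 ^ p], so that halving [k] times costs a power of [n <= 2 ^ k]. *)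
have [p Bp] : exists p : nat, B <= 2 ^+ p.
  exists (Num.truncn B).+1.
  rewrite (le_trans (ltW (truncnS_gt B)))// -natrX ler_nat.
  by rewrite ltnW// ltn_expl.
have s20 : 0 < s / 2 by rewrite divr_gt0.
have [D D0 pD] := powr_le_expR p s20.
exists (C * D), x0; split=> //; first by rewrite mulr_gt0.
move=> n x n0 x0x; have xp : 0 < x by exact: lt_le_trans x0x.
pose k := up_log 2 n.
have nk : (n <= 2 ^ k)%N by exact: up_logP.
have kn : (2 ^ k <= 2 * n)%N.
  have [n1|n1] := eqVneq n 1%N; first by rewrite /k n1 up_log1.
  have {}n1 : (1 < n)%N by rewrite ltn_neqAle eq_sym n1.
  have k0 : (0 < k)%N by rewrite up_log_gt0.
  by rewrite -(prednK k0) expnS leq_mul2l/= ltnW// up_log_gtn.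
rewrite (le_trans (G_anti _ (_ : x / 2 ^+ k <= _))) ?divr_gt0 ?exprn_gt0//.
  by rewrite ler_pM2l// lef_pV2 ?posrE ?exprn_gt0 ?ltr0n// -natrX ler_nat.
rewrite (le_trans (GB k x x0x))// ler_pM2r ?G_gt0// -mulrA ler_pM2l//.
have -> : s * n%:R = s / 2 * (2 * n)%:R by rewrite natrM mulrA divfK.
rewrite (le_trans _ (pD _ _))//.
rewrite (le_trans (_ : _ <= (2 ^+ p) ^+ k))//.
  by rewrite lerXn2r// nnegrE ?exprn_ge0// (le_trans _ B1).
rewrite exprAC lerXn2r// ?nnegrE ?exprn_ge0//.
by rewrite -natrX ler_nat.
Qed.

End heavy_tail.

Section distribution_classes_eps.
Context {R : realType}.
Variable V : set (measurableTypeR R) -> \bar R.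

Lemma class_L_le (a e : R) : class_L V -> 0 < a -> 0 < e ->
  exists2 x0, 0 < x0 & forall x, x0 <= x -> tail V (x - a) <= (1 + e) * tail V x.
Proof.
move=> [V0 VL] a0 e0; have /cvgrPdist_le /(_ e e0) [x0 [_ x0P]] := VL a a0.
exists (Num.max x0 0 + 1) => [|x xx]; first by rewrite ltr_wpDl// le_max lexx orbT.
have := x0P x; rewrite (lt_le_trans _ xx) ?ltr_pwDr ?le_max ?lexx//.
move=> /(_ isT); rewrite distrC ler_distl => /andP[_].
by rewrite ler_pdivrMr.
Qed.

Lemma class_D_le (b : R) : class_D V -> 0 < b < 1 ->
  exists B x0, 0 < x0 /\ forall x, x0 <= x -> tail V (b * x) <= B * tail V x.
Proof.
move=> [V0 VD] b01; have := VD b b01.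
rewrite /limf_esup => /ereal_inf_lt[_ [W [x0 [_ x0P]] <-] Wy].
have [B WB] : exists B : R, forall x, W x -> tail V (b * x) / tail V x <= B.
  case E : (ereal_sup _) Wy => [B| |] // _.
    exists B => x Wx; rewrite -lee_fin -E; apply: ereal_sup_ubound.
    by exists x.
  exists 0 => x Wx; suff : ((tail V (b * x) / tail V x)%:E <= -oo)%E by [].
  by rewrite -E; apply: ereal_sup_ubound; exists x.
exists B, (Num.max x0 0 + 1); split; first by rewrite ltr_wpDl// le_max lexx orbT.
move=> x xx; rewrite -ler_pdivrMr//; apply: WB; apply: x0P.
by rewrite (lt_le_trans _ xx) ?ltr_pwDr ?le_max ?lexx.
Qed.

End distribution_classes_eps.

(** * Exponential decay of the number of claims *)

Section renewal.
Context {R : realType} {dT : measure_display} {T : measurableType dT}.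
Variable P : probability T R.
Variables (tau : nat -> {RV P >-> R}) (N : R -> T -> nat).
Hypothesis tauN : renewal_counting_process tau N.
Let theta n w : R := tau n.+1 w - tau n w.

Lemma arrival_le m n w : (m <= n)%N -> tau m w <= tau n w.
Proof.
case: tauN => _ theta0 _ _ _; elim: n => [|n IH]; first by rewrite leqn0 => /eqP->.
rewrite leq_eqVlt => /predU1P[->//|]; rewrite ltnS => /IH /le_trans; apply.
by rewrite -subr_ge0; exact: theta0.
Qed.

Lemma arrival_ge0 n w : 0 <= tau n w.
Proof. by case: tauN => tau0 _ _ _ _; rewrite -(tau0 w) arrival_le. Qed.

Lemma leq_count n t w : (n < N t w)%N = (tau n.+1 w <= t).
Proof. by case: tauN => _ _ _ _ ->. Qed.

Let measurable_theta n : measurable_fun setT (theta n).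
Proof. by apply: measurable_funB; exact: measurable_funPT. Qed.

Lemma measurable_arrival n t : measurable [set w | tau n w <= t].
Proof. by apply: measurable_ler => //; exact: measurable_funPT. Qed.

Let theta_le n a : measurable [set w | theta n w <= a].
Proof. exact: measurable_ler. Qed.

Let theta_law n a : P [set w | theta n w <= a]%R = P [set w | theta 0%N w <= a]%R.
Proof.
case: tauN => _ _ _ law _.
have := law n `]-oo, a]%classic (measurable_itv _); rewrite /pushforward.
by rewrite !preimage_itvNyc.
Qed.

(** Were the interarrival times almost surely zero, all arrivals would take
    place at time [0], against the finiteness of [N 0]. *)
Let theta_spread : exists2 a, 0 < a &
  exists2 r : R, 0 < r < 1 & (P [set w | (theta 0%N w <= a)%R] <= r%:E)%E.
Proof.
apply: contrapT => nP.
have P1 a : 0 < a -> P [set w | theta 0%N w <= a] = 1%E.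
  move=> a0; apply/eqP; rewrite eq_le probability_le1//= leNgt; apply/negP => lt1.
  have fP : P [set w | theta 0%N w <= a] = (fine (P [set w | theta 0%N w <= a]))%:E.
    by rewrite fineK// fin_num_measure.
  apply: nP; exists a => //.
  exists (Num.max 2^-1 (fine (P [set w | theta 0%N w <= a]))); last first.
    by rewrite fP lee_fin le_max lexx orbT.
  rewrite lt_max gt_max invr_gt0 ltr0n/= invf_lt1// ltr1n/=.
  by rewrite -lte_fin -fP.
have : P.-negligible [set: T].
  apply: (@negligibleS _ _ _ _ (\bigcup_n \bigcup_k ~` [set w | theta n w <= k.+1%:R^-1])).
    move=> w _; apply: contrapT => nw.
    have thw n : theta n w = 0.
      apply/eqP; rewrite eq_le; case: tauN => _ -> _ _ _; rewrite andbT.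
      apply/ler_addgt0Pr => e e0; rewrite add0r leNgt; apply/negP => ew.
      apply: nw; exists n => //; exists (Num.truncn e^-1) => // /=.
      apply/negP; rewrite -ltNge (le_lt_trans _ ew)//.
      by rewrite -[leRHS]invrK lef_pV2 ?posrE ?invr_gt0// ltW// truncnS_gt.
    have tauw n : tau n w = 0.
      elim: n => [|n IH]; first by case: tauN.
      by move: (thw n); rewrite /theta IH subr0.
    by have := leq_count (N 0 w) 0 w; rewrite ltnn tauw lexx.
  apply: negligible_bigcup => n; apply: negligible_bigcup => k.
  apply/negligibleP; first exact: measurableC.
  rewrite [LHS](@probability_setC _ _ _ P [set w | theta n w <= k.+1%:R^-1])//.
  by rewrite theta_law P1 ?subee// invr_gt0.
move/negligibleP => /(_ measurableT) PT0; have := probability_setT P.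
by move=> /esym /eqP; rewrite [X in _ == X](_ : _ = 0%E)// onee_eq0.
Qed.

(** Split the indices [1, ..., k * j] into [k] blocks of length [j]. If each
    block contains an interarrival time larger than [a], then the arrival
    number [k * j + 1] takes place after [k * a]. *)
Let arrival_block (a r t : R) (k j : nat) :
  0 < a -> 0 <= r -> (P [set w | (theta 0%N w <= a)%R] <= r%:E)%E -> t < a *+ k ->
  (P [set w | (tau (k * j).+1 w <= t)%R] <=
     (k%:R * r ^+ j)%:E * P [set w | (tau 1%N w <= t)%R])%E.
Proof.
move=> a0 r0 thr tk; have [t0 _ _ _ _] := tauN.
have theta0E w : theta 0%N w = tau 1%N w by rewrite /theta t0 subr0.
pose E (i : nat) := if i is 0%N then [set w | theta 0%N w <= t]
                  else [set w | theta i w <= a].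
pose B b := \big[setI/setT]_(i <- 0%N :: iota (b * j).+1 j) E i.
have mE i : measurable (E i) by case: i => [|i]; exact: theta_le.
have mB b : measurable (B b).
  by rewrite /B; elim/big_rec : _ => // i D _ mD; exact: measurableI.
have pE s : all (leq 1) s -> (\prod_(i <- s) P (E i) <= (r ^+ size s)%:E)%E.
  elim: s => [|[|i] s IH]//=; first by rewrite big_nil.
  move=> /IH {}IH; rewrite big_cons exprS EFinM lee_pmul//.
    by elim/big_rec : _ => // ? x _ x0; rewrite mule_ge0.
  by rewrite /E theta_law.
have PB b : (P (B b) <= (r ^+ j)%:E * P [set w | (tau 1%N w <= t)%R])%E.
  rewrite /B (mutually_independent_bigcap (G := fun n => sigma_of [set n] theta)).
  - rewrite big_cons muleC; apply: lee_pmul => //.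
    + by elim/big_rec : _ => // i x _ x0; rewrite mule_ge0.
    + have := pE (iota (b * j).+1 j); rewrite size_iota; apply; apply/allP => i.
      by rewrite mem_iota => /andP[/(leq_trans _)-> //].
    + by rewrite /E (_ : [set w | theta 0%N w <= t] = [set w | tau 1%N w <= t])//;
        apply/seteqP; split => w /=; rewrite theta0E.
  - by case: tauN.
  - by rewrite /= iota_uniq mem_iota.
  - move=> [|i] _; rewrite /E.
      by rewrite -(preimage_itvNyc (theta 0%N)); exact: sigma_of_preimage.
    by rewrite -(preimage_itvNyc (theta i.+1)); exact: sigma_of_preimage.
have BP w b : ~ B b w -> tau (k * j).+1 w <= t -> (b < k)%N ->
    tau (b * j).+1 w + a <= tau (b.+1 * j).+1 w.
  rewrite /B -bigcap_seq => /existsNP[i /not_implyP[+ nEi]] taut bk.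
  rewrite /= inE => /predU1P[i0|].
    exfalso; apply: nEi; rewrite i0 /E /= theta0E.
    by rewrite (le_trans _ taut)// arrival_le.
  rewrite mem_iota => /andP[bi ib]; move: nEi; case: i bi ib => // i bi ib.
  rewrite /E /= => /negP; rewrite -ltNge /theta => ai.
  rewrite (le_trans (_ : _ <= tau i.+1 w + a))//.
    by rewrite lerD2r arrival_le.
  rewrite (le_trans (_ : _ <= tau i.+2 w))//.
    by rewrite -lerBrDl ltW.
  by apply: arrival_le; rewrite mulSn addnC; move: ib; rewrite addSn.
have sub : [set w | tau (k * j).+1 w <= t] `<=` \big[setU/set0]_(b < k) B b.
  move=> w /= taut; apply: contrapT; rewrite -bigcup_mkord => nB.
  have nBb b : (b < k)%N -> ~ B b w by move=> bk Bb; apply: nB; exists b.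
  have : a *+ k <= tau (k * j).+1 w.
    have : (k <= k)%N by []; elim: {-2}k => [|b IH] bk.
      by rewrite mulr0n arrival_ge0.
    rewrite mulrSr (le_trans _ (BP w b _ _ _))//; last exact: nBb.
    by rewrite lerD2r IH// ltnW.
  by move=> /(lt_le_trans tk) /lt_le_trans /(_ taut); rewrite ltxx.
have mtau : measurable [set w | tau (k * j).+1 w <= t] by exact: measurable_arrival.
apply: le_trans (content_subadditive P (fun b _ => mB b) mtau sub) _.
apply: le_trans (lee_sum _ (fun (b : 'I_k) _ => PB b)) _.
rewrite -(fineK (fin_num_measure P _ (measurable_arrival 1%N t))) -!EFinM sumEFin.
by rewrite lee_fin sumr_const card_ord -[leLHS]mulr_natl mulrA.
Qed.

(** Exponential decay of the law of the number of claims, with the factor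
    [P(tau 1 <= t)] that makes the estimate uniform for small [t]. *)
Lemma arrival_exp_decay (S : R) : exists s C, [/\ 0 < s, 0 < C &
  forall n t, (0 < n)%N -> t <= S -> (P [set w | (tau n w <= t)%R] <=
    (C * expR (- s * n%:R))%:E * P [set w | (tau 1%N w <= t)%R])%E].
Proof.
have [a a0 [r /andP[r0 r1] ar]] := theta_spread.
pose k := (Num.truncn (S / a)).+1.
have Sk : S < a *+ k.
  by rewrite -mulr_natr -ltr_pdivrMl// mulrC truncnS_gt.
have k0 : 0 < k%:R :> R by rewrite ltr0n.
pose s := - ln r / k%:R.
have s0 : 0 < s by rewrite divr_gt0// oppr_gt0 ln_lt0// r0.
exists s, (k%:R * expR (s * k%:R)); split=> //; first by rewrite mulr_gt0// expR_gt0.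
move=> n t n0 tS; pose j := (n.-1 %/ k)%N.
have kjn : (k * j < n)%N.
  by rewrite -(prednK n0) ltnS mulnC leq_divM.
have nkj : (n <= k * j + k)%N.
  by rewrite -(prednK n0) -mulnSr mulnC ltn_ceil.
apply: (@le_trans _ _ (P [set w | (tau (k * j).+1 w <= t)%R])).
  apply: le_measure; rewrite ?inE; [exact: measurable_arrival..|].
  by move=> w /=; apply: le_trans; exact: arrival_le.
rewrite (le_trans (arrival_block j a0 (ltW r0) ar (le_lt_trans tS Sk)))//.
apply: lee_pmul => //; rewrite lee_fin ?mulr_ge0 ?exprn_ge0 ?(ltW r0)//.
rewrite -mulrA ler_pM2l// -expRD.
have -> : r ^+ j = expR (- s * (k * j)%:R).
  rewrite natrM mulrA (_ : - s * k%:R = ln r); last first.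
    by rewrite /s; field; rewrite gt_eqF.
  by rewrite mulrC expRM_natl lnK// posrE.
rewrite ler_expR -subr_ge0 (_ : _ - _ = s * ((k * j + k)%:R - n%:R)).
  by rewrite mulr_ge0 ?(ltW s0)// subr_ge0 ler_nat.
by rewrite natrD; ring.
Qed.

End renewal.

(** * The renewal measure *)

Section renewal_measure.
Context {R : realType} {dT : measure_display} {T : measurableType dT}.
Variable P : probability T R.
Variables (tau : nat -> {RV P >-> R}) (N : R -> T -> nat) (lam : cumulative R R).
Hypothesis tauN : renewal_counting_process tau N.
Hypothesis lamE : renewal_function P N lam.

Lemma renewal_function_series t :
  (lam t)%:E = (\sum_(i <oo) P [set w | (tau i.+1 w <= t)%R])%E.
Proof.
rewrite -lamE unlock.
transitivity (\int[P]_w \sum_(i <oo) (\1_[set w | tau i.+1 w <= t] w : R)%:E)%E.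
  apply: eq_integral => w _; rewrite (nneseries_split 0 (N t w)); last first.
    by move=> k _; rewrite lee_fin.
  rewrite add0n eseries0 ?adde0; last first.
    move=> i Ni _; rewrite indicE memNset//= -(leq_count tauN).
    by rewrite ltnNge Ni.
  rewrite (eq_big_nat _ _ (F2 := fun=> 1%E)); last first.
    move=> i /andP[_ iN]; rewrite indicE mem_set//=.
    by rewrite -(leq_count tauN).
  by rewrite sumEFin big_const_nat subn0 iter_addr_0.
rewrite integral_nneseries//.
- apply: eq_eseriesr => i _; rewrite integral_indic ?setIT//.
  exact: measurable_arrival.
- move=> n; apply/measurable_EFinP; apply: measurable_indic.
  exact: measurable_arrival.
Qed.

Let measurable_tau i :
  measurable_fun setT (tau i.+1 : T -> measurableTypeR R).
Proof. exact: (@measurable_funPT _ _ _ _ (tau i.+1)). Qed.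

Let tau' i : {RV P >-> measurableTypeR R} :=
  HB.pack (tau i.+1 : T -> measurableTypeR R)
    (isMeasurableFun.Build _ _ _ _ _ (@measurable_tau i)).

Let arrival_law i : {measure set (measurableTypeR R) -> \bar R} :=
  distribution P (tau' i).

(** Both measures give [E[N t]] to the half-lines [(-oo, t]], hence they agree
    on bounded half-open intervals, which determine the renewal measure. *)
Lemma renewal_measureE (A : set (measurableTypeR R)) : measurable A ->
  lebesgue_stieltjes_measure lam A = mseries arrival_law 0 A.
Proof.
move: A; apply: lebesgue_stieltjes_measure_unique => _ [[a b] /= _ <-].
have muNy t : mseries arrival_law 0 `]-oo, t]%classic = (lam t)%:E.
  rewrite renewal_function_series /mseries; apply: eq_eseriesr => i _.
  by rewrite /arrival_law /distribution /pushforward.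
have [ab|ba] := leP a b; last first.
  by rewrite set_itv_ge ?measure0// -leNgt bnd_simp ltW.
rewrite /lebesgue_stieltjes_measure /measure_extension measurable_mu_extE/=; last first.
  exact: is_ocitv.
rewrite wlength_itv_bnd//.
have /esym := muNy b; rewrite (_ : `]-oo, b] = `]-oo, a] `|` `]a, b])%classic; last first.
  by rewrite -itv_bndbnd_setU// bnd_simp.
rewrite measureU//; last first.
  apply/seteqP; split => // x [] /=; rewrite !in_itv/= => xa /andP[ax _].
  by have := lt_le_trans ax xa; rewrite ltxx.
rewrite [X in (X + _)%E](muNy a) EFinB => ->.
by rewrite addeAC subee// add0e.
Qed.

Lemma renewal_measure_itv t :
  lebesgue_stieltjes_measure lam `[0%R, t]%classic = (lam t)%:E.
Proof.
rewrite renewal_measureE// renewal_function_series /mseries.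
apply: eq_eseriesr => i _; rewrite /arrival_law /distribution /pushforward.
congr (P _); apply/seteqP; split => w /=; rewrite in_itv/=.
  by case/andP.
by move=> ->; rewrite (arrival_ge0 tauN).
Qed.

Lemma renewal_integral (H : R -> \bar R) t :
  (forall s, 0 <= H s)%E -> measurable_fun (setT : set (measurableTypeR R)) H ->
  (\int[lebesgue_stieltjes_measure lam]_(s in `[0%R, t]) H s =
   \sum_(i <oo) \int[P]_(w in [set w | (tau i.+1 w <= t)%R]) H (tau i.+1 w))%E.
Proof.
move=> H0 mH.
rewrite (eq_measure_integral (mseries arrival_law 0)); last first.
  by move=> A mA _; exact: renewal_measureE.
rewrite ge0_integral_measure_series//; last exact: measurable_funTS.
apply: eq_eseriesr => i _; rewrite /arrival_law /distribution.
rewrite ge0_integral_pushforward//=; last exact: measurable_funTS.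
congr (integral _ _ _); apply/seteqP; split => w /=; rewrite in_itv/=.
  by case/andP.
by move=> ->; rewrite (arrival_ge0 tauN).
Qed.

End renewal_measure.

(** * The discounted surplus process *)

Section surplus.
Context {R : realType} {dT : measure_display} {T : measurableType dT}.
Context {P : probability T R} {d : nat}.
Variables (X : nat -> {RV P >-> 'rV[R]_d}) (tau : nat -> {RV P >-> R}).
Variables (N : R -> T -> nat) (xi : R -> {RV P >-> R}) (c : R -> T -> 'rV[R]_d).
Variables (M l : 'rV[R]_d) (L : set 'rV[R]_d).
Hypothesis X_ge0 : forall n w, nonneg_vec (X n w).
Hypothesis tauN : renewal_counting_process tau N.
Hypothesis xi_cadlag : forall w, cadlag (fun t => xi t w).
Hypothesis measurable_c :
  measurable_fun [set p : measurableTypeR R * T | 0 <= p.1] (fun p => c p.1 p.2).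
Hypothesis c_bounded : forall t w k, 0 <= t -> 0 <= c t w 0 k <= M 0 k.
Hypothesis l_gt0 : forall k, 0 < l 0 k.
Hypothesis ruinL : ruin_set L.

Let A := minus_set l L.
Let hA : scrR A. Proof. exact: ruin_set_scrR. Qed.

Definition discount i w : R := expR (- xi (tau i.+1 w) w).

Definition claims t w : 'rV[R]_d :=
  \sum_(i < N t w) discount i w *: X i w.

Definition premiums t w : 'rV[R]_d :=
  \row_k (\int[lebesgue_measure]_(s in `[0, t]) (expR (- xi s w) * c s w 0 k)).

Let xi_right w s : 0 <= s -> xi r w @[r --> s^'+] --> xi s w.
Proof. exact: (xi_cadlag w).1. Qed.

Lemma measurable_path :
  measurable_fun setT (fun p : measurableTypeR R * T => xi (Num.max 0 p.1) p.2).
Proof.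
exact: (@measurable_right_continuous _ _ _ (fun s w => xi s w)).
Qed.

Lemma measurable_discount i : measurable_fun setT (discount i).
Proof.
apply: measurableT_comp => //; apply: measurableT_comp => //.
rewrite (_ : (fun w => _) = (fun p : measurableTypeR R * T => xi (Num.max 0 p.1) p.2) \o
    (fun w => (tau i.+1 w, w))).
  apply: (measurableT_comp measurable_path).
  by apply: measurable_fun_pair => //; exact: (@measurable_funPT _ _ _ _ (tau i.+1)).
by apply/funext => w /=; rewrite max_r// (arrival_ge0 tauN).
Qed.

Lemma measurable_claim i k : measurable_fun setT (fun w => X i w 0 k).
Proof.
by apply: (measurableT_comp (measurable_coord k)); exact: measurable_funPT.
Qed.

Lemma measurable_claims t k : measurable_fun setT (fun w => claims t w 0 k).
Proof.
rewrite (_ : (fun w => _) = fun w => \sum_(i < N t w) discount i w * X i w 0 k).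
  apply: (measurable_fun_nat_index (h := fun n w => \sum_(i < n) discount i w * X i w 0 k)).
    move=> [|n].
      rewrite (_ : _ @^-1` _ = ~` [set w | tau 1%N w <= t]).
        by apply: measurableC; exact: measurable_arrival.
      apply/seteqP; split => w /=; rewrite -(leq_count tauN).
        by move=> ->.
      by move/negP; rewrite -leqNgt leqn0 => /eqP.
    rewrite (_ : _ @^-1` _ = [set w | tau n.+1 w <= t] `\` [set w | tau n.+2 w <= t]).
      by apply: measurableD; exact: measurable_arrival.
    apply/seteqP; split => w /=; rewrite -!(leq_count tauN).
      by move=> ->; rewrite ltnn.
    by move=> [nN /negP]; rewrite -leqNgt => Nn; apply/eqP; rewrite eqn_leq Nn.
  move=> n; apply: measurable_sum => i; apply: measurable_funM.
    exact: measurable_discount.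
  exact: measurable_claim.
apply/funext => w; rewrite /claims summxE; apply: eq_bigr => i _.
by rewrite mxE.
Qed.

Let premium_rate k (p : measurableTypeR R * T) :=
  expR (- xi (Num.max 0 p.1) p.2) * c p.1 p.2 0 k.

Let measurable_premium_rate k :
  measurable_fun [set p : measurableTypeR R * T | 0 <= p.1] (premium_rate k).
Proof.
apply: measurable_funM.
  apply: measurable_funTS; apply: measurableT_comp => //; apply: measurableT_comp => //.
  exact: measurable_path.
by apply: (measurableT_comp (measurable_coord k)).
Qed.

Let mpos : measurable [set p : measurableTypeR R * T | 0 <= p.1].
Proof. by apply: measurable_ler => //; exact: measurable_fst. Qed.

Let premium_rate_itv (t : R) k :
  measurable_fun setT
    ((premium_rate k) \_ [set p : measurableTypeR R * T | 0 <= p.1 <= t]).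
Proof.
have -> : [set p : measurableTypeR R * T | 0 <= p.1 <= t] =
    [set p : measurableTypeR R * T | 0 <= p.1] `&` [set p | p.1 <= t].
  by apply/seteqP; split => p /=; [move/andP|move=> [-> ->]].
have mt : measurable [set p : measurableTypeR R * T | p.1 <= t].
  by apply: measurable_ler => //; exact: measurable_fst.
apply/(measurable_restrictT _ (measurableI _ _ mpos mt)).
by apply: measurable_funS (measurable_premium_rate k) => // p [].
Qed.

Lemma measurable_premiums t k : measurable_fun setT (fun w => premiums t w 0 k).
Proof.
pose f (p : measurableTypeR R * T) : \bar R :=
  (((premium_rate k) \_ [set p : measurableTypeR R * T | 0 <= p.1 <= t]) p)%:E.
have f0 p : (0 <= f p)%E.
  rewrite /f patchE; case: ifPn => //; rewrite inE /= => /andP[p0 _].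
  by rewrite lee_fin mulr_ge0// ?expR_ge0//; have /andP[] := c_bounded p.2 k p0.
have mf : measurable_fun setT f by apply/measurable_EFinP; exact: premium_rate_itv.
rewrite (_ : (fun w => _) = fine \o fubini_G lebesgue_measure f).
  apply: measurableT_comp => //.
  exact: (measurable_fun_fubini_tonelli_G (m1 := lebesgue_measure) f mf f0).
apply/funext => w; rewrite mxE /Rintegral /= /fubini_G; congr fine.
rewrite [LHS]integral_mkcond; congr (integral _ _ _); apply/funext => s.
rewrite /f !patchE mem_setE; case: ifPn; rewrite in_itv/= => s0t.
  by rewrite mem_set// /premium_rate/= max_r//; case/andP: s0t.
by rewrite memNset//=; exact/negP.
Qed.

Lemma premiums_ge0 t w : nonneg_vec (premiums t w).
Proof.
move=> k; rewrite mxE; apply: Rintegral_ge0 => s /=; rewrite in_itv/= => /andP[s0 _].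
by rewrite mulr_ge0 ?expR_ge0//; have /andP[] := c_bounded w k s0.
Qed.

Let premium_integrable t w k :
  lebesgue_measure.-integrable `[0, t] (EFin \o (fun s => expR (- xi s w) * c s w 0 k)).
Proof.
have [B xiB] := cadlag_bounded t (xi_cadlag w).
apply: measurable_bounded_integrable => //=.
- rewrite lebesgue_measure_itv /=; case: ifPn => // _.
  by rewrite -EFinD ltry.
- have := measurableT_comp (premium_rate_itv t k) (pair2_measurable w).
  move=> /measurable_funTS-/(_ `[0, t]%classic).
  apply: eq_measurable_fun => s; rewrite inE /= in_itv/= => s0t.
  rewrite patchE mem_set//= /premium_rate /= max_r//.
  by case/andP: s0t.
- exists (expR B * M 0 k); split; first exact: num_real.
  move=> r Br s /=; rewrite in_itv/= => /[dup] s0t /andP[s0 _].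
  have /andP[c0 cM] := c_bounded w k s0.
  rewrite (le_trans _ (ltW Br))// ger0_norm ?mulr_ge0 ?expR_ge0//.
  rewrite ler_pM ?expR_ge0// ler_expR lerNl.
  by have := xiB _ s0t; rewrite ler_norml => /andP[].
Qed.

Let premiums_right w s k : 0 <= s ->
  (fun r => premiums r w 0 k) @ s^'+ --> premiums s w 0 k.
Proof.
move=> s0; have s1 : 0 < s + 1 by rewrite ltr_wpDl.
have := parameterized_integral_continuous (ltW s1) (premium_integrable (s + 1) w k).
have -> : (parameterized_integral lebesgue_measure 0)^~ (fun s => expR (- xi s w) * c s w 0 k) =
    (fun r => premiums r w 0 k).
  by apply/funext => r; rewrite mxE.
move=> /(continuous_within_itvP _ s1)[cont cont0 _].
move: s0; rewrite le_eqVlt => /predU1P[<-//|s0].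
apply: cvg_at_right_filter; apply: cont.
by rewrite in_itv/= s0 ltrDl ltr01.
Qed.

Let count_right w s : \forall r \near s^'+, N r w = N s w.
Proof.
have sN : s < tau (N s w).+1 w by rewrite ltNge -(leq_count tauN) ltnn.
near=> r; have sr : s < r by near: r; exact: nbhs_right_gt.
have rN : r < tau (N s w).+1 w by near: r; exact: nbhs_right_lt.
apply/eqP; rewrite eqn_leq leqNgt (leq_count tauN) -ltNge rN /=.
case E : (N s w) => [//|n]; rewrite (leq_count tauN) (le_trans _ (ltW sr))//.
by rewrite -(leq_count tauN) E.
Unshelve. all: by end_near. Qed.

Lemma surplus_right x w s : 0 <= s ->
  L (discounted_surplus X (fun n => tau n) N (fun s => xi s) c l x s w) ->
  \forall r \near s^'+,
    L (discounted_surplus X (fun n => tau n) N (fun s => xi s) c l x r w).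
Proof.
move=> s0; set V := discounted_surplus _ _ _ _ _ _ _ => LV.
case: ruinL => oL _ _ _ _.
have /nbhs_ballP[e /= e0 eL] : nbhs (V s w) L by exact: open_nbhs_nbhs.
have nearp : \forall r \near s^'+, forall k,
    `|premiums s w 0 k - premiums r w 0 k| < e.
  apply: filter_forall => k.
  by have /cvgrPdist_lt/(_ e e0) := @premiums_right w s k s0.
apply: filterS2 nearp (count_right w s) => r pr Nr.
apply: eL; split => // i j; rewrite (ord1 i) /ball /= /V /discounted_surplus Nr.
rewrite -/(premiums r w) -/(premiums s w) !mxE opprD addrACA subrr addr0.
by rewrite opprD addrACA subrr add0r; have := pr j; rewrite !mxE.
Qed.

(** As [L] is a cone, the surplus enters [L] exactly when the net losses enter
    the dilation [x A]. *)
Lemma surplusP x s w : 0 < x ->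
  L (discounted_surplus X (fun n => tau n) N (fun s => xi s) c l x s w) <->
  scale_set x A (claims s w - premiums s w).
Proof.
move=> x0; rewrite scale_setP// /A minus_setE /=.
case: ruinL => _ _ _ _ /(_ x x0) LE.
rewrite -[in X in X <-> _]LE scale_setP// /discounted_surplus.
rewrite -/(premiums s w) -/(claims s w).
rewrite -addrA scalerDr scalerA mulVf ?gt_eqF// scale1r.
by rewrite -[X in l - X]opprK -scalerN opprB opprK.
Qed.

Lemma measurable_ruin x t : 0 < x -> 0 < t ->
  measurable (ruin_event X (fun n => tau n) N (fun s => xi s) c l L x t).
Proof.
move=> x0 t0.
apply: (measurable_hitting (E := fun s => [set w |
  L (discounted_surplus X (fun n => tau n) N (fun s => xi s) c l x s w)])) => //; last first.
  by move=> s w s0; exact: surplus_right.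
move=> s s0; rewrite (_ : [set w | _] =
    (fun w => claims s w - premiums s w) @^-1` scale_set x A).
  apply: measurable_preimage_increasing.
  - by apply: open_scale_set => //; case: hA.
  - by move=> v v' Av v0; exact: (scale_set_increasing hA x0 v0 Av).
  move=> k; rewrite (_ : (fun w => _) = (fun w => claims s w 0 k - premiums s w 0 k)).
    apply: measurable_funB; [exact: measurable_claims|exact: measurable_premiums].
  by apply/funext => w; rewrite mxE [X in _ + X = _]mxE.
by apply/funext => w; apply/propext; exact: surplusP.
Qed.

(** Dropping the premiums and adding up the claims until [t] only makes the
    losses larger; the total is then measured by the subadditive functional. *)
Lemma ruin_total_claims x t w : 0 < x ->
  ruin_event X (fun n => tau n) N (fun s => xi s) c l L x t w ->
  x < \sum_(i < N t w) discount i w * Y_ A (X i w).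
Proof.
move=> x0 [s]; rewrite in_itv/= => /andP[s0 st] /surplusP-/(_ x0).
move=> /(scale_set_increasing hA x0 (premiums_ge0 s w)); rewrite subrK.
move=> /(lt_gaugeP hA _ x0) /lt_le_trans; apply.
have Nst : (N s w <= N t w)%N.
  case E : (N s w) => [//|n]; rewrite (leq_count tauN) (le_trans _ st)//.
  by rewrite -(leq_count tauN) E.
rewrite (le_trans (gauge_sum hA _ _))//; first by move=> i; exact: expR_gt0.
rewrite (big_ord_widen (N t w) (fun i => discount i w * Y_ A (X i w)) Nst).
rewrite [leRHS](bigID (fun i : 'I_(N t w) => (i < N s w)%N))/= lerDl.
by rewrite sumr_ge0// => i _; rewrite mulr_ge0 ?expR_ge0// gauge_ge0.
Qed.

(** The discounted premiums up to the horizon are bounded by a fixed vector, so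
    they lie outside [K A] for some [K]; ruin is then observed at time [t]
    itself, whatever the (possibly null) arrival time of the large claim. *)
Lemma large_claim_ruin (S C1 : R) : 0 < S -> exists2 K, 0 < K & forall x t w i,
  (forall s, 0 <= s <= S -> - C1 <= xi s w) -> 0 < x -> 0 < t <= S ->
  tau i.+1 w <= t -> scale_set (x + K) A (discount i w *: X i w) ->
  ruin_event X (fun n => tau n) N (fun s => xi s) c l L x t w.
Proof.
move=> S0; pose B : 'rV[R]_d := \row_k (S * expR C1 * M 0 k).
have [K K0 nKB] := scale_set_bounded hA B.
exists K => // x t w i xiC1 x0 /andP[t0 tS] taut ZA.
exists t; first by rewrite in_itv/= t0 lexx.
apply/surplusP => //; apply: contrapT => nA.
have premB : nonneg_vec (B - premiums t w).
  move=> k; rewrite !mxE subr_ge0.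
  have intB : lebesgue_measure.-integrable `[0, t] (EFin \o cst (expR C1 * M 0 k)).
    apply: measurable_bounded_integrable => //=; last exact: bounded_cst.
    by rewrite lebesgue_measure_itv /= lte_fin t0 -EFinD ltry.
  apply: (@le_trans _ _ (\int[lebesgue_measure]_(s in `[0, t]) cst (expR C1 * M 0 k) s)).
    apply: (le_Rintegral _ (premium_integrable t w k) intB) => //.
    move=> s /=; rewrite in_itv/= => /andP[s0 st].
    have /andP[c0 cM] := c_bounded w k s0.
    by rewrite ler_pM ?expR_ge0// ler_expR lerNl xiC1// s0 (le_trans st).
  rewrite Rintegral_cst//= lebesgue_measure_itv /= lte_fin t0 -EFinD/= subr0.
  rewrite mulrC -mulrA ler_wpM2r//.
  have /andP[c0 cM] := c_bounded w k (lexx 0).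
  by rewrite mulr_ge0 ?expR_ge0// (le_trans c0).
have nP : ~ scale_set K A (premiums t w).
  by move=> /(scale_set_increasing hA K0 premB); rewrite subrKC.
have : scale_set (x + K) A (claims t w).
  rewrite (_ : claims t w = discount i w *: X i w +
      (claims t w - discount i w *: X i w)); last by rewrite subrKC.
  apply: (scale_set_increasing hA (addr_gt0 x0 K0) _ ZA).
  move=> k; rewrite /claims.
  have iN : (i < N t w)%N by rewrite (leq_count tauN).
  rewrite (bigD1 (Ordinal iN))//= addrAC subrr add0r summxE sumr_ge0// => j _.
  by rewrite mxE mulr_ge0 ?expR_ge0//; exact: X_ge0.
rewrite -(subrK (premiums t w) (claims t w)).
by move=> /(scale_setD hA x0 K0)[].
Qed.

End surplus.

(** * The expected number of large discounted claims *)

Section discounted_claims.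
Context {R : realType} {dT : measure_display} {T : measurableType dT}.
Context {P : probability T R} {d : nat}.
Variables (X : nat -> {RV P >-> 'rV[R]_d}) (tau : nat -> {RV P >-> R}).
Variables (N : R -> T -> nat) (xi : R -> {RV P >-> R}) (c : R -> T -> 'rV[R]_d).
Variables (lam : cumulative R R) (A : set 'rV[R]_d).
Variables (F : probability 'rV[R]_d R) (X0 : {RV P >-> 'rV[R]_d}).
Hypothesis hA : scrR A.
Hypothesis tauN : renewal_counting_process tau N.
Hypothesis lamE : renewal_function P N lam.
Hypothesis xi_cadlag : forall w, cadlag (fun t => xi t w).
Hypothesis X_law : forall n, has_law P (X n) F.
Hypothesis indepXNxi : mutually_independent_seq P
    [:: sigma_of setT X; sigma_of [set t | 0 <= t] N;
        sigma_of [set t | 0 <= t] xi; sigma_of [set t | 0 <= t] c].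
Hypothesis X0_law : has_law P X0 F.
Hypothesis indepX0xi : mutually_independent_seq P
    [:: sigma_of setT (fun _ : unit => X0); sigma_of [set t | 0 <= t] xi].

Local Notation G := (tail (law_on F A)).

Let oA : open A. Proof. by case: hA. Qed.

Lemma measurable_scale_set u : 0 < u -> measurable (scale_set u A).
Proof. by move=> u0; apply: sub_sigma_algebra; exact: open_scale_set. Qed.

Lemma measurable_scale_set_preimage {d1} {S : measurableType d1} (V : S -> 'rV[R]_d) u :
  0 < u -> (forall k, measurable_fun setT (fun w => V w 0 k)) ->
  measurable [set w | scale_set u A (V w)].
Proof.
move=> u0 mV; apply: (measurable_preimage_increasing (A := scale_set u A)) => //.
  exact: open_scale_set.
by move=> v v' Av v0; exact: (scale_set_increasing hA u0 v0 Av).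
Qed.

Lemma tailE u : 0 < u -> F (scale_set u A) = (G u)%:E.
Proof.
move=> u0; rewrite /tail /law_on /pushforward.
rewrite (_ : _ @^-1` _ = scale_set u A).
  by rewrite fineK// fin_num_measure//; exact: measurable_scale_set.
apply/funext => v; apply/propext; rewrite -(lt_gaugeP hA v u0) /=.
by rewrite in_itv/= andbT.
Qed.

Lemma claim_tail n u : 0 < u -> P [set w | scale_set u A (X n w)] = (G u)%:E.
Proof.
by move=> u0; rewrite -tailE//; apply: X_law; exact: measurable_scale_set.
Qed.

Lemma tail_le1 u : 0 < u -> G u <= 1.
Proof.
move=> u0; rewrite -lee_fin -tailE//; apply: probability_le1.
exact: measurable_scale_set.
Qed.

Lemma tail_anti u v : 0 < u -> u <= v -> G v <= G u.
Proof.
move=> u0 uv; have v0 := lt_le_trans u0 uv.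
rewrite -lee_fin -!tailE//; apply: le_measure; rewrite ?inE.
- exact: measurable_scale_set.
- exact: measurable_scale_set.
- by move=> w; exact: scale_set_le.
Qed.

Lemma tail_ge0 u : 0 < u -> 0 <= G u.
Proof. by move=> u0; rewrite -lee_fin -tailE. Qed.

(** Given [xi s = r], the discounted claim exceeds [u] when the claim itself
    exceeds [u * expR r]. *)
Lemma discounted_tail (Z : {RV P >-> 'rV[R]_d}) s u : 0 < u -> has_law P Z F ->
  (forall B C, measurable B -> measurable C ->
    P (xi s @^-1` C `&` Z @^-1` B) = (P (xi s @^-1` C) * P (Z @^-1` B))%E) ->
  P [set w | scale_set u A (expR (- xi s w) *: Z w)] =
  (\int[P]_w (G (u * expR (xi s w)))%:E)%E.
Proof.
move=> u0 ZF ind.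
pose E := [set p : R * 'rV[R]_d | scale_set u A (expR (- p.1) *: p.2)].
have mE : measurable E.
  apply: measurable_scale_set_preimage => // k.
  under eq_fun do rewrite mxE; apply: measurable_funM.
    apply: measurableT_comp => //; apply: measurableT_comp => //.
  exact: (measurableT_comp (measurable_coord k)).
have xiZ C B : measurable C -> measurable B ->
    P (xi s @^-1` C `&` Z @^-1` B) = (P (xi s @^-1` C) * P (Z @^-1` B))%E.
  by move=> mC mB; exact: ind.
have := probability_indep_prod (measurable_funPT (xi s)) (measurable_funPT Z) xiZ mE.
rewrite /E /= => ->; apply: eq_integral => w _.
have ue0 : 0 < u * expR (xi s w) by rewrite mulr_gt0// expR_gt0.
rewrite -tailE// -ZF//; last exact: measurable_scale_set.
congr (P _); apply/funext => w'; apply/propext => /=.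
rewrite !scale_setP// scalerA invfM expRN.
by rewrite mulrC.
Qed.

(** A pi-system generating the joint sigma-algebra of the claims and of the
    return process, from which the arrivals are independent. *)
Let GXxi : set (set T) :=
  [set E | exists2 EX, sigma_of setT X EX &
           exists2 Exi, sigma_of [set t | 0 <= t] xi Exi & E = EX `&` Exi].

Let GXxi_measurable : GXxi `<=` measurable.
Proof.
move=> _ [EX mEX [Exi mExi ->]]; apply: measurableI.
  by apply: sigma_of_measurable mEX => i _; exact: measurable_funPT.
by apply: sigma_of_measurable mExi => i _; exact: measurable_funPT.
Qed.

Let GXxi_setI : setI_closed GXxi.
Proof.
move=> _ _ [EX mEX [Exi mExi ->]] [EX' mEX' [Exi' mExi' ->]].
exists (EX `&` EX'); first exact: sigma_of_setI.
by exists (Exi `&` Exi'); [exact: sigma_of_setI|rewrite setIACA].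
Qed.

Let GXxiT : GXxi setT.
Proof.
by exists setT; [exact: sigma_ofT|exists setT; [exact: sigma_ofT|rewrite setIT]].
Qed.

Let indep3 EX EN Exi : sigma_of setT X EX ->
  sigma_of [set t | 0 <= t] N EN -> sigma_of [set t | 0 <= t] xi Exi ->
  P (EX `&` EN `&` Exi) = (P EX * P EN * P Exi)%E.
Proof. by apply: (indep_seq4 _ indepXNxi); exact: sigma_ofT. Qed.

Lemma arrival_sigma_of n (B : set R) : measurable B ->
  sigma_of [set t | 0 <= t] N (tau n.+1 @^-1` B).
Proof.
pose D := \bigcup_(t in [set t : R | 0 <= t])
  preimage_set_system setT (N t) (measurable : set (set nat)).
have mtau : measurable_fun (setT : set (g_sigma_algebraType D))
    (tau n.+1 : g_sigma_algebraType D -> R).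
  apply: (measurability _ (RGenOInfty.measurableE R)) => //.
  move=> _ [_ [a ->] <-]; rewrite setTI preimage_itvoy.
  rewrite (_ : [set w | a < tau n.+1 w] = ~` [set w | tau n.+1 w <= a]); last first.
    by apply/seteqP; split => w /=; rewrite ltNge => /negP.
  apply: measurableC; have [a0|a0] := ltP a 0.
    rewrite (_ : [set w | _] = set0)//; apply/seteqP; split => w //= ta.
    by have := le_lt_trans (arrival_ge0 tauN n.+1 w) (le_lt_trans ta a0); rewrite ltxx.
  rewrite (_ : [set w | _] = N a @^-1` [set k | (n < k)%N]); last first.
    by apply/seteqP; split => w /=; rewrite (leq_count tauN).
  exact: (sigma_of_preimage (D := [set t | 0 <= t]) (Y := N) a0).
by move=> mB; rewrite -[X in sigma_of _ _ X]setTI; exact: mtau.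
Qed.

Lemma indep_claims_arrival EX n t : sigma_of setT X EX ->
  P (EX `&` [set w | tau n.+1 w <= t]) = (P EX * P [set w | (tau n.+1 w <= t)%R])%E.
Proof.
move=> mEX.
have mN := arrival_sigma_of n (B := `]-oo, t]%classic) (measurable_itv _).
have := indep3 mEX mN (@sigma_ofT _ _ _ _ _ [set t | 0 <= t] xi).
by rewrite setIT probability_setT mule1 preimage_itvNyc.
Qed.

Let indep_X_xi EX Exi : sigma_of setT X EX -> sigma_of [set t | 0 <= t] xi Exi ->
  P (EX `&` Exi) = (P EX * P Exi)%E.
Proof.
move=> mEX mExi; have := indep3 mEX (@sigma_ofT _ _ _ _ _ [set t | 0 <= t] N) mExi.
by rewrite setIT probability_setT mule1.
Qed.

Lemma discounted_claim_tail n s u : 0 <= s -> 0 < u ->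
  P [set w | scale_set u A (expR (- xi s w) *: X n w)] =
  (\int[P]_w (G (u * expR (xi s w)))%:E)%E.
Proof.
move=> s0 u0; apply: discounted_tail => // B C mB mC.
rewrite setIC muleC; apply: indep_X_xi.
  exact: (sigma_of_preimage (Y := X) (i := n) I mB).
exact: (sigma_of_preimage (Y := xi) (i := s) s0 mC).
Qed.

Lemma discounted_claim0_tail s u : 0 <= s -> 0 < u ->
  P [set w | scale_set u A (expR (- xi s w) *: X0 w)] =
  (\int[P]_w (G (u * expR (xi s w)))%:E)%E.
Proof.
move=> s0 u0; apply: discounted_tail => // B C mB mC.
rewrite setIC muleC; apply: (indep_seq2 indepX0xi).
  exact: (sigma_of_preimage (Y := fun _ : unit => X0) (i := tt) I mB).
exact: (sigma_of_preimage (Y := xi) (i := s) s0 mC).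
Qed.

Definition big_claim u t i : set T := [set w | tau i.+1 w <= t /\
  scale_set u A (discount tau xi i w *: X i w)].

Let K u s := P [set w | scale_set u A (expR (- xi (Num.max 0 s) w) *: X0 w)].

(** The arrival time is independent of the pair (claim, return process), so it
    may be frozen; the claim is then replaced by [X0], as both are independent
    of the return process with the same law. *)
Let big_claim_integral u t i : 0 < u ->
  P (big_claim u t i) =
  (\int[P]_(w in [set w | (tau i.+1 w <= t)%R]) K u (tau i.+1 w))%E.
Proof.
move=> u0; pose S := g_sigma_algebraType GXxi.
have mid : measurable_fun setT (id : T -> S).
  move=> _ B mB; rewrite setTI; move: mB; apply: smallest_sub => //.
  exact: sigma_algebra_measurable.
have mxi s : 0 <= s -> measurable_fun setT (xi s : S -> R).
  move=> s0 _ B mB; rewrite setTI; apply: sub_sigma_algebra.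
  exists setT; first exact: sigma_ofT.
  exists (xi s @^-1` B); last by rewrite setTI.
  exact: (sigma_of_preimage (Y := xi) (i := s) s0 mB).
have mX k : measurable_fun setT (fun w : S => X i w 0 k).
  move=> _ B mB; rewrite setTI; apply: sub_sigma_algebra.
  exists ((fun w => X i w 0 k) @^-1` B); last first.
    by exists setT; [exact: sigma_ofT|rewrite setIT].
  have mB' := measurable_coord k measurableT mB; rewrite setTI in mB'.
  exact: (sigma_of_preimage (Y := X) (i := i) I mB').
pose E := [set p : measurableTypeR R * S | p.1 <= t /\
  scale_set u A (expR (- xi (Num.max 0 p.1) p.2) *: X i p.2)].
have mE : measurable E.
  apply: (@measurableI _ _ [set p : measurableTypeR R * S | p.1 <= t]).
    by apply: measurable_ler => //; exact: measurable_fst.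
  apply: measurable_scale_set_preimage => // k.
  under eq_fun do rewrite mxE; apply: measurable_funM.
    apply: measurableT_comp => //; apply: measurableT_comp => //.
    apply: (@measurable_right_continuous _ _ S (fun s w => xi s w)) => //.
    by move=> w s s0; exact: (xi_cadlag w).1.
  exact: (measurableT_comp (mX k)).
have mtau : measurable_fun setT (tau i.+1 : T -> measurableTypeR R).
  exact: (@measurable_funPT _ _ _ _ (tau i.+1)).
have ind (B : set (measurableTypeR R)) (D : set S) : measurable B -> measurable D ->
    P (tau i.+1 @^-1` B `&` id @^-1` D) = (P (tau i.+1 @^-1` B) * P (id @^-1` D))%E.
  move=> mB mD; rewrite preimage_id; apply: (indep_sigma (G := GXxi)) => //.
    by rewrite -[X in measurable X]setTI; exact: mtau.
  move=> _ [EX mEX [Exi mExi ->]].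
  have := indep3 mEX (arrival_sigma_of i mB) mExi.
  rewrite setIAC [in X in X -> _]setIC => ->.
  by rewrite muleAC indep_X_xi// muleC.
transitivity (P [set w | E (tau i.+1 w, id w)]).
  congr (P _); apply/seteqP; split => w; rewrite /E /big_claim /discount /=;
    by rewrite max_r// (arrival_ge0 tauN).
rewrite (probability_indep_prod mtau mid ind mE).
rewrite [RHS]integral_mkcond; apply: eq_integral => w _.
rewrite patchE; case: ifPn => [|]; rewrite ?inE ?notin_setE /= => taut.
  have max0 : 0 <= Num.max 0 (tau i.+1 w) by rewrite le_max lexx.
  rewrite /K discounted_claim0_tail// -(discounted_claim_tail i)//.
  by congr (P _); apply/seteqP; split => w' /=; [case|split].
rewrite (_ : [set w' | _] = set0) ?measure0//.
by apply/seteqP; split => w' //= [].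
Qed.

Let measurable_K u : 0 < u ->
  measurable_fun (setT : set (measurableTypeR R)) (K u).
Proof.
move=> u0; pose E := [set p : measurableTypeR R * T |
  scale_set u A (expR (- xi (Num.max 0 p.1) p.2) *: X0 p.2)].
have mE : measurable E.
  apply: measurable_scale_set_preimage => // k.
  under eq_fun do rewrite mxE; apply: measurable_funM.
    apply: measurableT_comp => //; apply: measurableT_comp => //.
    exact: measurable_path.
  apply: (measurableT_comp (measurable_coord k)).
  exact: (measurableT_comp (measurable_funPT X0)).
have := measurable_fun_xsection P mE.
congr (measurable_fun _ _); apply/funext => s; rewrite /K.
by congr (P _); apply/seteqP; split => w /=; rewrite /xsection /= inE.
Qed.

Lemma measurable_discounted_tail u t : 0 < u ->
  measurable_fun (`[0%R, t]%classic : set (measurableTypeR R))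
    (fun s => P [set w | scale_set u A (expR (- xi s w) *: X0 w)]).
Proof.
move=> u0; have := measurable_funTS (measurable_K u0) (D := `[0%R, t]%classic).
apply: eq_measurable_fun => s; rewrite inE /= in_itv/= => /andP[s0 _].
by rewrite /K max_r.
Qed.

Definition tail_integral u t : \bar R :=
  (\int[lebesgue_stieltjes_measure lam]_(s in `[0%R, t])
     P [set w | scale_set u A (expR (- xi s w) *: X0 w)]%R)%E.

(** The renewal measure being the sum of the laws of the arrival times, the
    integral is the expected number of large discounted claims. *)
Lemma big_claim_series u t : 0 < u ->
  (\sum_(i <oo) P (big_claim u t i))%E = tail_integral u t.
Proof.
move=> u0; rewrite /tail_integral.
transitivity (\int[lebesgue_stieltjes_measure lam]_(s in `[0%R, t]) K u s)%E; last first.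
  apply: eq_integral => s; rewrite inE /= in_itv/= => /andP[s0 _].
  by rewrite /K max_r.
rewrite (renewal_integral tauN lamE).
- by apply: eq_eseriesr => i _; exact: big_claim_integral.
- by move=> s; exact: measure_ge0.
- exact: measurable_K.
Qed.

(** In the remainder of the section, [Om] is an almost sure event on which the
    return process is bounded up to the horizon [S]; comparisons of tails that
    hold there are integrated over the return process and over the arrivals. *)
Variables (S C1 C2 : R) (Om : set T).
Hypothesis mOm : measurable Om.
Hypothesis POm : P Om = 1%E.
Hypothesis xi_Om : forall w, Om w -> forall s, 0 <= s <= S -> - C1 <= xi s w <= C2.

Let measurable_G s u : 0 < u ->
  measurable_fun setT (fun w => (G (u * expR (xi s w)))%:E).
Proof.
move=> u0; apply/measurable_EFinP.
(* [G] is only known to be monotone on the positive reals. *)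
pose H x := if 0 < x then G x else 1.
have mH : measurable_fun setT H.
  apply: nonincreasing_measurable => // x y xy; rewrite /H.
  have [x0|x0] := ltP 0 x; first by rewrite (lt_le_trans x0 xy) tail_anti.
  by case: ifPn => // y0; exact: tail_le1.
rewrite (_ : (fun w => _) = H \o (fun w => u * expR (xi s w))).
  apply: (measurableT_comp mH); apply: measurable_funM => //.
  by apply: measurableT_comp.
by apply/funext => w; rewrite /H /= mulr_gt0// expR_gt0.
Qed.

Let le_integral_Om (f g : T -> \bar R) :
  (forall w, 0 <= f w)%E -> (forall w, 0 <= g w)%E ->
  measurable_fun setT f -> measurable_fun setT g ->
  (forall w, Om w -> (f w <= g w)%E) -> (\int[P]_w f w <= \int[P]_w g w)%E.
Proof.
move=> f0 g0 mf mg fg; apply: ae_ge0_le_integral => //.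
have POmC : P (~` Om) = 0%E by rewrite probability_setC// POm subee.
exists (~` Om); split; [exact: measurableC|exact: POmC|].
by move=> w; apply: contra_not => Omw _; exact: fg.
Qed.

Lemma tail_integral_ge u t : 0 < u -> t <= S ->
  ((G (expR C2 * u) * lam t)%:E <= tail_integral u t)%E.
Proof.
move=> u0 tS; have eu0 : 0 < expR C2 * u by rewrite mulr_gt0// expR_gt0.
rewrite EFinM -(renewal_measure_itv tauN lamE) -integral_cst//.
apply: ge0_le_integral => //.
- by move=> s _; rewrite lee_fin tail_ge0.
- exact: measurable_discounted_tail.
move=> s /=; rewrite in_itv/= => /andP[s0 st].
rewrite discounted_claim0_tail//.
apply: (@le_trans _ _ (\int[P]_w (G (expR C2 * u))%:E)%E).
  rewrite integral_cst// [X in (_ * X)%E](_ : _ = 1%E) ?mule1//.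
  exact: probability_setT.
apply: le_integral_Om.
- by move=> w; rewrite lee_fin tail_ge0.
- by move=> w; rewrite lee_fin tail_ge0// mulr_gt0// expR_gt0.
- exact: measurable_cst.
- exact: measurable_G.
move=> w /xi_Om/(_ s); rewrite s0 (le_trans st tS) => /(_ isT) /andP[_ xC2].
rewrite lee_fin tail_anti ?mulr_gt0 ?expR_gt0//.
by rewrite mulrC ler_pM2r// ler_expR.
Qed.

Hypothesis F_L : class_L (law_on F A).

(** On [Om], a shift of [x] by [h] shifts the argument of [G] by at most
    [h * expR C2], while this argument is at least [x * expR (- C1)]: long-tailedness
    applies uniformly in time. *)
Lemma tail_integral_shift (e h : R) : 0 < e -> 0 < h -> exists2 x0, h < x0 &
  forall x t, x0 <= x -> t <= S -> (tail_integral (x - h) t <= (1 + e)%:E * tail_integral x t)%E.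
Proof.
move=> e0 h0; have h'0 : 0 < h * expR C2 by rewrite mulr_gt0// expR_gt0.
have [x1 x10 x1P] := class_L_le F_L h'0 e0.
exists (h + x1 * expR C1 + h * expR C2 * expR C1) => [|x t x0x tS].
  by rewrite -addrA ltrDl addr_gt0 ?mulr_gt0 ?expR_gt0.
have hx : h < x.
  by rewrite (lt_le_trans _ x0x)// -addrA ltrDl addr_gt0 ?mulr_gt0 ?expR_gt0.
have x0 : 0 < x by exact: lt_trans hx.
have xh0 : 0 < x - h by rewrite subr_gt0.
have e1 : 0 <= 1 + e by rewrite addr_ge0// ltW.
rewrite /tail_integral -ge0_integralZl//; last exact: measurable_discounted_tail.
apply: ge0_le_integral => //.
- exact: measurable_discounted_tail.
- by apply: measurable_funeM; exact: measurable_discounted_tail.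
move=> s /=; rewrite in_itv/= => /andP[s0 st].
rewrite !discounted_claim0_tail// -ge0_integralZl//; last 2 first.
- exact: measurable_G.
- by move=> w _; rewrite lee_fin tail_ge0// mulr_gt0// expR_gt0.
apply: le_integral_Om.
- by move=> w; rewrite lee_fin tail_ge0// mulr_gt0// expR_gt0.
- by move=> w; rewrite mule_ge0// lee_fin tail_ge0// mulr_gt0// expR_gt0.
- exact: measurable_G.
- by apply: measurable_funeM; exact: measurable_G.
move=> w /xi_Om/(_ s); rewrite s0 (le_trans st tS) => /(_ isT) /andP[xC1 xC2].
have xe : x1 + h * expR C2 <= x * expR (xi s w).
  rewrite (@le_trans _ _ (x * expR (- C1)))//; last first.
    by rewrite ler_pM2l// ler_expR.
  rewrite expRN ler_pdivlMr ?expR_gt0// mulrDl (le_trans _ x0x)//.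
  by rewrite -addrA lerDr ltW.
have x1x : x1 <= x * expR (xi s w) by rewrite (le_trans _ xe)// lerDl ltW.
rewrite -EFinM lee_fin (le_trans _ (x1P _ x1x))// tail_anti//.
  by rewrite subr_gt0 (lt_le_trans _ xe)// ltrDr.
by rewrite mulrBl lerD2l lerN2 ler_pM2l// ler_expR.
Qed.

Lemma tail_integral_fin u t : 0 < u -> tail_integral u t \is a fin_num.
Proof.
move=> u0; rewrite ge0_fin_numE; last by apply: integral_ge0 => s _; exact: measure_ge0.
apply: (@le_lt_trans _ _ (lam t)%:E); last exact: ltry.
rewrite -(renewal_measure_itv tauN lamE) -[leRHS]mul1e -integral_cst//.
apply: ge0_le_integral => //.
- exact: measurable_discounted_tail.
move=> s _; apply: probability_le1.
apply: measurable_scale_set_preimage => // k.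
under eq_fun do rewrite mxE; apply: measurable_funM.
  by apply: measurableT_comp => //; apply: measurableT_comp.
by apply: (measurableT_comp (measurable_coord k)); exact: measurable_funPT.
Qed.

End discounted_claims.

(** * Bonferroni's inequality, large sums, geometric series *)

Section bonferroni.
Context {R : realType} {dT : measure_display} {T : measurableType dT}.
Variables (P : probability T R) (B : nat -> set T).
Hypothesis mB : forall i, measurable (B i).

Lemma bonferroni m : (\sum_(i < m) P (B i) <=
  P (\big[setU/set0]_(i < m) B i) + \sum_(i < m) \sum_(j < i) P (B i `&` B j))%E.
Proof.
elim: m => [|m IH]; first by rewrite !big_ord0 adde0 measure_ge0.
rewrite !big_ord_recr /=; set U := \big[setU/set0]_(i < m) B i in IH *.
have mU : measurable U by exact: bigsetU_measurable.
have BU : (P (B m `&` U) <= \sum_(j < m) P (B m `&` B j))%E.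
  apply: (@content_subadditive _ _ _ P _ (fun j => B m `&` B j) m) => //.
  - by move=> k _; exact: measurableI.
  - exact: measurableI.
  - by rewrite /U big_distrr.
have -> : U `|` B m = U `|` (B m `\` U) by rewrite setUDr setDv setD0.
have -> : P (U `|` (B m `\` U)) = (P U + P (B m `\` U))%E.
  by rewrite measureU//; [exact: measurableD|rewrite setDE setICA setICr setI0].
have -> : P (B m) = (P (B m `\` U) + P (B m `&` U))%E by rewrite -measureDI.
by rewrite [leRHS]addeACA; apply: leeD => //; exact: leeD.
Qed.

End bonferroni.

Lemma probability_bigsetU_le {R : realType} {dT : measure_display}
    {T : measurableType dT} (P : probability T R) {I : Type} (r : seq I)
    (Q : pred I) (B : I -> set T) : (forall i, measurable (B i)) ->
  (P (\big[setU/set0]_(i <- r | Q i) B i) <= \sum_(i <- r | Q i) P (B i))%E.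
Proof.
move=> mB.
suff [] : measurable (\big[setU/set0]_(i <- r | Q i) B i) /\
  (P (\big[setU/set0]_(i <- r | Q i) B i) <= \sum_(i <- r | Q i) P (B i))%E by [].
elim/big_rec2 : _ => [|i p D _ [mD Dp]]; first by rewrite measure0.
split; first exact: measurableU.
by rewrite (le_trans (measureU2 P (mB i) mD))// leeD.
Qed.

Lemma exists_gt_average {R : realType} n (J : pred 'I_n) (a : 'I_n -> R) (x : R) :
  (0 < n)%N -> 0 <= x -> x < \sum_(i < n | J i) a i ->
  exists2 i, J i & x / n%:R < a i.
Proof.
move=> n0 x0 xa; apply: contrapT => na; move: xa; apply/negP; rewrite -leNgt.
have xn : 0 <= x / n%:R by rewrite divr_ge0.
have ax i : J i -> a i <= x / n%:R.
  by move=> Ji; rewrite leNgt; apply/negP => xai; apply: na; exists i.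
rewrite (le_trans (ler_sum _ ax))// sumr_const -[leLHS]mulr_natr.
rewrite mulrAC ler_pdivrMr ?ltr0n// ler_wpM2l// ler_nat.
by rewrite (leq_trans (max_card _))// card_ord.
Qed.

(** Some term exceeds the average [x / n]; if it is at most [x - h], then the
    other terms share more than [h]. *)
Lemma sum_gt_cases {R : realType} n (a : 'I_n -> R) (x h : R) :
  (0 < n)%N -> 0 <= h -> 0 < x -> (forall i, 0 <= a i) -> x < \sum_(i < n) a i ->
  (exists i, x - h < a i) \/
  exists i j, [/\ i != j, x / n%:R < a i & h / n%:R < a j].
Proof.
move=> n0 h0 x0 a0 xa; have [i _ ai] := exists_gt_average n0 (ltW x0) xa.
have [xh|ax] := ltP (x - h) (a i); [by left; exists i|right].
move: xa; rewrite (bigD1 i)//= => xa.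
have : h < \sum_(j < n | j != i) a j.
  by rewrite -(ltrD2l (a i)) (le_lt_trans _ xa)// -lerBrDr.
by move=> /(exists_gt_average n0 h0)[j ji aj]; exists i, j; rewrite eq_sym.
Qed.

Section geometric_tail.
Context {R : realType}.

Lemma geometric_tail (C q e : R) : 0 <= C -> 0 < q < 1 -> 0 < e ->
  exists m, (\sum_(m <= n <oo) (C * q ^+ n)%:E <= e%:E)%E.
Proof.
move=> C0 /andP[q0 q1] e0; have q1' : `|q| < 1 by rewrite gtr0_norm.
have q1B : 0 < 1 - q by rewrite subr_gt0.
have [m _ /(_ _ (leqnn m)) mP] :
    \forall m \near \oo, `|geometric C q m| < e * (1 - q).
  have /cvgrPdist_lt/(_ (e * (1 - q))) := cvg_geometric C q1'.
  rewrite mulr_gt0// => /(_ isT); apply: filterS => m.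
  by rewrite sub0r normrN.
exists m; apply: lime_le.
  by apply: is_cvg_nneseries => n _ _; rewrite lee_fin mulr_ge0// exprn_ge0// ltW.
apply: nearW => n; rewrite sumEFin lee_fin.
have [nm|mn] := leqP n m; first by rewrite big_geq// ltW.
rewrite -(subnKC (ltnW mn)) -mulr_sumr geometric_partial_tail.
rewrite (le_trans (ler_wpM2l C0 (geometric_le_lim _ _ q0 q1')))//.
  by rewrite exprn_ge0// ltW.
rewrite mulrA ler_pdivrMr//; apply: ltW; rewrite (le_lt_trans _ mP)//.
by rewrite ger0_norm// mulr_ge0// exprn_ge0// ltW.
Qed.

End geometric_tail.

(** * The principle of a single big jump *)

Section one_big_jump.
Context {R : realType} {dT : measure_display} {T : measurableType dT}.
Context {P : probability T R} {d : nat}.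
Variables (X : nat -> {RV P >-> 'rV[R]_d}) (tau : nat -> {RV P >-> R}).
Variables (N : R -> T -> nat) (lam : cumulative R R) (A : set 'rV[R]_d).
Variables (F : probability 'rV[R]_d R) (D : nat -> T -> R).
Variables (S b kappa : R) (Om : set T).
Hypothesis hA : scrR A.
Hypothesis X_ge0 : forall n w, nonneg_vec (X n w).
Hypothesis tauN : renewal_counting_process tau N.
Hypothesis lamE : renewal_function P N lam.
Hypothesis X_law : forall n, has_law P (X n) F.
Hypothesis F_D : class_D (law_on F A).
Hypothesis tai : forall i j, i != j ->
  tail_asymptotically_independent P (Y_ A \o X i) (Y_ A \o X j).
Hypothesis indepXN : forall EX n t, sigma_of setT X EX ->
  P (EX `&` [set w | tau n.+1 w <= t]) = (P EX * P [set w | (tau n.+1 w <= t)%R])%E.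
Hypothesis D_gt0 : forall i w, 0 < D i w.
Hypothesis measurable_D : forall i, measurable_fun setT (D i).
Hypothesis kappa0 : 0 < kappa.
Hypothesis b0 : 0 < b.
Hypothesis mOm : measurable Om.
Hypothesis POm : P Om = 1%E.
Hypothesis D_le : forall i w, Om w -> tau i.+1 w <= S -> D i w <= b.

Local Notation G := (tail (law_on F A)).

Let G_gt0 x : 0 < x -> 0 < G x. Proof. by case: F_D. Qed.

Let G_anti := tail_anti F hA.

(** The reference argument [kappa * x] is the one at which the tail bounds the
    limiting quantity from below. *)
Lemma tail_dilation_exp (s : R) : 0 < s -> exists C x0, [/\ 0 < C, 0 < x0 &
  forall n x, x0 <= x ->
    G (x / (n.+1%:R * b)) <= C * expR (s * n.+1%:R) * G (kappa * x)].
Proof.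
move=> s0; pose k := (Num.truncn (b * kappa)).+1.
have k0 : 0 < k%:R :> R by rewrite ltr0n.
have [||C [x0 [C0 x00 Cx0]]] := @tail_dilation _ _ G_gt0 (tail_le1 F hA) G_anti _ (s / k%:R).
- have [|B [x1 [x10 Bx1]]] := @class_D_le _ _ 2^-1 F_D.
    by rewrite invr_gt0 ltr0n invf_lt1// ltr1n.
  by exists B, x1; split=> // x /Bx1; rewrite mulrC.
- by rewrite divr_gt0.
exists C, (x0 / kappa); split=> //; first by rewrite divr_gt0.
move=> n x x0x; have x0' : 0 < x by apply: lt_le_trans x0x; rewrite divr_gt0.
have kx : x0 <= kappa * x by rewrite mulrC -ler_pdivrMr.
have := Cx0 (n.+1 * k)%N (kappa * x) isT kx.
rewrite natrM [n.+1%:R * _]mulrC mulrA divfK ?gt_eqF//; apply: le_trans.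
apply: G_anti; first by rewrite divr_gt0 ?mulr_gt0.
rewrite ler_pdivrMr ?mulr_gt0// mulrAC ler_pdivlMr ?mulr_gt0//.
rewrite [leLHS](_ : _ = x * n.+1%:R * (b * kappa)); last by ring.
rewrite [leRHS](_ : _ = x * n.+1%:R * k%:R); last by ring.
by rewrite ler_pM2l ?mulr_gt0// ltW// truncnS_gt.
Qed.

Lemma first_arrival_le t : (P [set w | (tau 1%N w <= t)%R] <= (lam t)%:E)%E.
Proof.
rewrite (renewal_function_series tauN lamE).
have := @nneseries_lim_ge R (fun i => P [set w | (tau i.+1 w <= t)%R]) xpredT 0 1.
by rewrite big_nat1; apply => n _ _; exact: measure_ge0.
Qed.

Let lam_ge0 t : 0 <= lam t.
Proof. by rewrite -lee_fin (le_trans _ (first_arrival_le t)). Qed.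

(** The event of at least [n.+1] claims contributes negligibly for large [n]:
    its probability decays exponentially, while one of [n] claims exceeding
    [x / n] costs at most an arbitrarily small exponential rate. *)
Lemma many_claims_negligible (e : R) : 0 < e -> exists m x0, 0 < x0 /\
  forall x t, x0 <= x -> t <= S ->
  (\sum_(m <= n <oo) (n.+1%:R * G (x / (n.+1%:R * b)))%:E *
                     P [set w | (tau n.+1 w <= t)%R] <=
   (e * G (kappa * x) * lam t)%:E)%E.
Proof.
move=> e0; have [s [C1 [s0 C10 decay]]] := arrival_exp_decay tauN S.
have s40 : 0 < s / 4%:R by rewrite divr_gt0.
have [C2 [x0 [C20 x00 dil]]] := tail_dilation_exp s40.
have [C3 C30 lin] := powr_le_expR 1 s40.
pose C := C1 * C2 * C3; have C0 : 0 < C by rewrite !mulr_gt0.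
pose q := expR (- (s / 2%:R)).
have q01 : 0 < q < 1 by rewrite expR_gt0 expR_lt1 oppr_lt0 divr_gt0.
have [m mP] := geometric_tail (ltW C0) q01 e0.
exists m, x0; split=> // x t x0x tS; have x0' := lt_le_trans x00 x0x.
have Gx : 0 <= G (kappa * x) by rewrite ltW// G_gt0// mulr_gt0.
have Gl : 0 <= G (kappa * x) * lam t by rewrite mulr_ge0.
have term n : ((n.+1%:R * G (x / (n.+1%:R * b)))%:E * P [set w | (tau n.+1 w <= t)%R] <=
    (G (kappa * x) * lam t)%:E * (C * q ^+ n)%:E)%E.
  have G0 : 0 <= G (x / (n.+1%:R * b)) by rewrite ltW// G_gt0// divr_gt0// mulr_gt0.
  apply: (@le_trans _ _ ((C3 * expR (s / 4%:R * n.+1%:R) *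
      (C2 * expR (s / 4%:R * n.+1%:R) * G (kappa * x)))%:E *
      ((C1 * expR (- s * n.+1%:R))%:E * (lam t)%:E))%E).
    apply: lee_pmul => //; first by rewrite lee_fin mulr_ge0.
      rewrite lee_fin ler_pM//; last exact: dil.
      by have := lin n.+1%:R (ler0n _ _); rewrite expr1.
    rewrite (le_trans (decay _ _ _ tS))//.
    apply: lee_pmul => //; last exact: first_arrival_le.
    by rewrite lee_fin mulr_ge0 ?expR_ge0// ltW.
  rewrite -!EFinM lee_fin.
  rewrite [leLHS](_ : _ = G (kappa * x) * lam t * (C * (expR (s / 4%:R * n.+1%:R) *
      expR (s / 4%:R * n.+1%:R) * expR (- s * n.+1%:R)))); last first.
    by rewrite /C; ring.
  rewrite ler_wpM2l// ler_pM2l// -!expRD /q -expRM_natr ler_expR.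
  rewrite [leLHS](_ : _ = - (s / 2%:R) * n.+1%:R); last by field.
  by rewrite !mulNr lerN2 ler_pM2l ?divr_gt0// ler_nat.
apply: (le_trans (lee_nneseries _ (fun n _ => term n))).
  move=> n _ _; apply: mule_ge0 => //; rewrite lee_fin mulr_ge0//.
  by rewrite ltW// G_gt0// divr_gt0// mulr_gt0.
rewrite nneseriesZl; last first.
  by move=> n _; rewrite lee_fin mulr_ge0 ?(ltW C0)// exprn_ge0// expR_ge0.
apply: (le_trans (lee_wpmul2l _ mP)); first by rewrite lee_fin.
by rewrite -EFinM lee_fin mulrC mulrA.
Qed.

(** The bound involves the tail at [p] only: with [q] fixed and [p] of order
    [x], two large claims are negligible with respect to a single one. *)
Lemma two_large_claims (m : nat) (e : R) : 0 < e -> exists2 z, 0 < z &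
  forall i j p q, (i < m)%N -> (j < m)%N -> i != j -> z <= p -> z <= q ->
  (P ([set w | scale_set p A (X i w)] `&` [set w | scale_set q A (X j w)]) <=
   (e * G p)%:E)%E.
Proof.
move=> e0.
have pair i j : exists z, 0 < z /\ (i != j -> forall p q, z <= p -> z <= q ->
  (P ([set w | scale_set p A (X i w)] `&` [set w | scale_set q A (X j w)]) <=
   (e * G p)%:E)%E).
  have [->|ij] := eqVneq i j; first by exists 1; split.
  have ji : j != i by rewrite eq_sym.
  have /cvgrPdist_le/(_ e e0)[[B1 B2] /= [[z1 [_ z1P]] [z2 [_ z2P]]] BP] := tai ji.
  exists (Num.max 1 (Num.max (z1 + 1) (z2 + 1))); split; first by rewrite lt_max ltr01.
  move=> _ p q; rewrite !ge_max => /and3P[p1 _ z2p] /and3P[q1 z1q _].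
  have p0 : 0 < p := lt_le_trans ltr01 p1; have q0 : 0 < q := lt_le_trans ltr01 q1.
  have GE i' u : 0 < u -> P [set w | u < (Y_ A \o X i') w] = (G u)%:E.
    move=> u0; rewrite -(claim_tail hA X_law i' u0); congr (P _).
    by apply/funext => w; apply/propext; exact: lt_gaugeP.
  have mE i' u : 0 < u -> measurable [set w | scale_set u A (X i' w)].
    move=> u0; apply: (measurable_scale_set_preimage hA) => // k.
    exact: measurable_claim.
  have setE : [set w | scale_set p A (X i w)] `&` [set w | scale_set q A (X j w)] =
      [set w | q < (Y_ A \o X j) w] `&` [set w | p < (Y_ A \o X i) w].
    by rewrite setIC; congr (_ `&` _); apply/funext => w; apply/propext;
      rewrite /= lt_gaugeP.
  have B12 : (B1 `*` B2) (q, p).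
    by split; [apply: z1P; rewrite (lt_le_trans _ z1q)// ltrDl|
               apply: z2P; rewrite (lt_le_trans _ z2p)// ltrDl].
  have := BP _ B12; rewrite /= -setE GE//= sub0r normrN => /(le_trans (ler_norm _)).
  rewrite ler_pdivrMr ?G_gt0// => fle.
  rewrite -(fineK (fin_num_measure P _ _)) ?lee_fin//.
  by apply: measurableI; exact: mE.
have [z zP] := choice (fun ij => pair ij.1 ij.2).
exists (\big[Num.max/1]_(ij : 'I_m * 'I_m) z (val ij.1, val ij.2)).
  by apply: lt_le_trans ltr01 _; exact: bigmax_ge_id.
move=> i j p q im jm ij zp zq.
have zle : z (i, j) <= \big[Num.max/1]_(ij : 'I_m * 'I_m) z (val ij.1, val ij.2).
  exact: (le_bigmax _ (fun ij : 'I_m * 'I_m => z (val ij.1, val ij.2)) (Ordinal im, Ordinal jm)).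
by apply: (zP (i, j)).2 => //; exact: le_trans zle _.
Qed.

Let pair_arrival i j p q t : 0 < p -> 0 < q ->
  P ([set w | scale_set p A (X i w)] `&` [set w | scale_set q A (X j w)] `&`
     [set w | tau 1%N w <= t]) =
  (P ([set w | scale_set p A (X i w)] `&` [set w | scale_set q A (X j w)]) *
   P [set w | (tau 1%N w <= t)%R])%E.
Proof.
move=> p0 q0; apply: indepXN; apply: sigma_of_setI.
  exact: (sigma_of_preimage (Y := X) (i := i) I (measurable_scale_set hA p0)).
exact: (sigma_of_preimage (Y := X) (i := j) I (measurable_scale_set hA q0)).
Qed.

Let claim_arrival i n u t : 0 < u ->
  P ([set w | scale_set u A (X i w)] `&` [set w | tau n.+1 w <= t]) =
  ((G u)%:E * P [set w | (tau n.+1 w <= t)%R])%E.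
Proof.
move=> u0; rewrite indepXN ?(claim_tail hA X_law)//.
exact: (sigma_of_preimage (Y := X) (i := i) I (measurable_scale_set hA u0)).
Qed.

Let mX i u : 0 < u -> measurable [set w | scale_set u A (X i w)].
Proof.
by move=> u0; apply: (measurable_scale_set_preimage hA) => // k; exact: measurable_claim.
Qed.

Let jump u t i : set T := [set w | tau i.+1 w <= t /\ scale_set u A (D i w *: X i w)].

Let measurable_jump u t i : 0 < u -> measurable (jump u t i).
Proof.
move=> u0; apply: (@measurableI _ _ [set w | tau i.+1 w <= t]).
  exact: measurable_arrival.
apply: (measurable_scale_set_preimage hA) => // k.
under eq_fun do rewrite mxE; apply: measurable_funM; first exact: measurable_D.
exact: measurable_claim.
Qed.

Let P_restr E : measurable E -> P E = P (E `&` Om).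
Proof.
move=> mE; rewrite [LHS](measureDI P mE mOm) [X in (X + _)%E](_ : _ = 0%E) ?add0e//.
apply/eqP; rewrite eq_le measure_ge0 andbT.
have <- : P (~` Om) = 0%E by rewrite probability_setC// POm subee.
apply: le_measure; rewrite ?inE; [exact: measurableD|exact: measurableC|].
by move=> w [].
Qed.

Let jump_le u t i : 0 < u -> t <= S ->
  jump u t i `&` Om `<=` [set w | scale_set (u / b) A (X i w)] `&` [set w | tau i.+1 w <= t].
Proof.
move=> u0 tS w [[taut uDX] Omw]; split=> //=.
have Db := D_le Omw (le_trans taut tS).
move: uDX; rewrite (scale_setZ hA _ u0 (D_gt0 i w)) => uDY.
apply/(lt_gaugeP hA); first by rewrite divr_gt0.
rewrite ltr_pdivrMr// mulrC (lt_le_trans uDY)// ler_wpM2r//.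
exact: gauge_ge0.
Qed.

Let first_arrival n t w : tau n.+1 w <= t -> tau 1%N w <= t.
Proof. by apply: le_trans; exact: (arrival_le tauN). Qed.

(** Upper bound: a large total of discounted claims comes either from a single
    large discounted claim, or from two large claims among the first [m], or
    from more than [m] claims; only the first case matters. *)
Lemma large_total_le (e : R) : 0 < e -> exists h x0, [/\ 0 < h, h < x0 &
  forall x t E, x0 <= x -> t <= S -> measurable E ->
  E `<=` [set w | x < \sum_(i < N t w) D i w * Y_ A (X i w)] ->
  (P E <= \sum_(i <oo) P (jump (x - h) t i) +
          (e * G (kappa * x) * lam t)%:E)%E].
Proof.
move=> e0; have e20 : 0 < e / 2 by rewrite divr_gt0.
have [m [x1 [x10 many]]] := many_claims_negligible e20.
have [C [x2 [C0 x20 dil]]] := tail_dilation_exp ltr01.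
pose C' := C * expR (1 * m.+1%:R).
have C'0 : 0 < C' by rewrite mulr_gt0 ?expR_gt0.
pose e' := e / 2 / (m.+1 * m.+1)%:R / C'.
have e'0 : 0 < e' by rewrite !divr_gt0.
have [z z0 two] := two_large_claims m.+1 e'0.
(* In a sum of at most [m.+1] discounted claims, exceeding the average [x / m.+1]
   requires an undiscounted claim larger than [x / q]; likewise [h] is such that
   the other claim exceeds [z]. *)
pose q := m.+1%:R * b; have q0 : 0 < q by rewrite mulr_gt0.
pose h := z * q; have h0 : 0 < h by rewrite mulr_gt0.
exists h, (h + x1 + x2); split=> //; first by rewrite -addrA ltrDl addr_gt0.
move=> x t E x0x tS mE Esub.
have hx : h < x by rewrite (lt_le_trans _ x0x)// -addrA ltrDl addr_gt0.
have x1x : x1 <= x by rewrite (le_trans _ x0x)// addrAC lerDr ltW ?addr_gt0.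
have x2x : x2 <= x by rewrite (le_trans _ x0x)// lerDr ltW ?addr_gt0.
have x0 : 0 < x by apply: lt_trans hx.
have xh0 : 0 < x - h by rewrite subr_gt0.
have zx : z <= x / q by rewrite ler_pdivlMr// ltW.
have xq0 : 0 < x / q by rewrite divr_gt0.
pose E1 := \bigcup_i jump (x - h) t i.
pose pair (ij : 'I_m.+1 * 'I_m.+1) := [set w | scale_set (x / q) A (X ij.1 w)] `&`
  [set w | scale_set z A (X ij.2 w)] `&` [set w | tau 1%N w <= t].
pose E2 := \big[setU/set0]_(ij : 'I_m.+1 * 'I_m.+1 | ij.1 != ij.2) pair ij.
pose claim_of n i := [set w | scale_set (x / (n.+1%:R * b)) A (X i w)] `&`
  [set w | tau n.+1 w <= t].
pose manyn n := \big[setU/set0]_(i < n.+1) claim_of n i.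
pose E3 := \bigcup_n (if (m <= n)%N then manyn n else set0).
have mE1 : measurable E1 by apply: bigcup_measurable => i _; exact: measurable_jump.
have mpair ij : measurable (pair ij).
  by apply: measurableI; [apply: measurableI; exact: mX|exact: measurable_arrival].
have mE2 : measurable E2 by exact: bigsetU_measurable.
have mclaim_of n i : measurable (claim_of n i).
  by apply: measurableI; [apply: mX; rewrite divr_gt0 ?mulr_gt0|exact: measurable_arrival].
have mE3 n : measurable (if (m <= n)%N then manyn n else set0).
  by case: ifPn => // _; exact: bigsetU_measurable.
have cover : E `&` Om `<=` E1 `|` E2 `|` E3.
  move=> w [/Esub /= xw Omw].
  have DY0 (i : 'I_(N t w)) : 0 <= D i w * Y_ A (X i w).
    by rewrite mulr_ge0 ?(ltW (D_gt0 _ _))// gauge_ge0.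
  have tauN' (i : nat) : (i < N t w)%N -> tau i.+1 w <= t by rewrite (leq_count tauN).
  have DYb u (i : 'I_(N t w)) : 0 < u -> u < D i w * Y_ A (X i w) ->
      scale_set (u / b) A (X i w).
    move=> u0 ui; have tauiS := le_trans (tauN' i (ltn_ord i)) tS.
    apply/(lt_gaugeP hA); first by rewrite divr_gt0.
    rewrite ltr_pdivrMr// mulrC (lt_le_trans ui)// ler_wpM2r ?gauge_ge0//.
    exact: D_le.
  have n0 : (0 < N t w)%N.
    rewrite lt0n; apply/eqP => n0; move: xw; rewrite big1 ?ltNge ?ltW// => -[i iN] _.
    by exfalso; move: iN; rewrite n0.
  have n0' : 0 < (N t w)%:R :> R by rewrite ltr0n.
  have [mn|nm] := leqP m (N t w).-1.
    right; exists (N t w).-1 => //; rewrite /= mn.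
    rewrite /manyn -(bigcup_mkord _ (claim_of (N t w).-1)).
    have [i _ xi] := exists_gt_average (J := xpredT) n0 (ltW x0) xw.
    exists i; first by rewrite /= prednK.
    split=> /=; last by rewrite tauN'// prednK.
    by rewrite prednK// invfM mulrA; apply: DYb => //; rewrite divr_gt0.
  left; have nm1 : (N t w <= m.+1)%N by rewrite -(prednK n0) ltnS ltnW.
  have [[i xi]|[i [j [ij xi hj]]]] := sum_gt_cases n0 (ltW h0) x0 DY0 xw.
    left; exists (val i) => //; split; first exact/tauN'/ltn_ord.
    by rewrite (scale_setZ hA).
  right; rewrite /E2 -bigcup_seq_cond.
  exists (widen_ord nm1 i, widen_ord nm1 j).
    by rewrite /= mem_index_enum/= -val_eqE.
  have le_m (u : R) : 0 <= u -> u / m.+1%:R <= u / (N t w)%:R.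
    move=> u0; apply: ler_wpM2l => //.
    by rewrite lef_pV2 ?posrE ?ltr0n// ler_nat.
  split; last by apply: (first_arrival (n := i)); exact/tauN'/ltn_ord.
  split => /=.
    have := DYb (x / m.+1%:R) i _ (le_lt_trans (le_m _ (ltW x0)) xi).
    by rewrite /q invfM mulrA; apply; rewrite divr_gt0.
  have := DYb (h / m.+1%:R) j _ (le_lt_trans (le_m _ (ltW h0)) hj).
  rewrite (_ : h / m.+1%:R / b = z); last first.
    by rewrite /h /q; field; rewrite gt_eqF//= pnatr_eq0.
  by apply; rewrite divr_gt0.
have PE1 : (P E1 <= \sum_(i <oo) P (jump (x - h) t i))%E.
  by apply: measure_sigma_subadditive => // i; exact: measurable_jump.
have Gx0 : 0 < G (kappa * x) by rewrite G_gt0// mulr_gt0.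
have PE2 : (P E2 <= (e / 2 * G (kappa * x) * lam t)%:E)%E.
  apply: (le_trans (probability_bigsetU_le P _ _ mpair)).
  apply: (@le_trans _ _ (\sum_(ij : 'I_m.+1 * 'I_m.+1)
      (e' * (C' * G (kappa * x)) * lam t)%:E)%E).
    rewrite [leRHS](bigID (fun ij : 'I_m.+1 * 'I_m.+1 => ij.1 != ij.2))/=.
    rewrite -[leLHS]adde0; apply: leeD; last first.
      apply: sume_ge0 => ij _; rewrite lee_fin; apply: mulr_ge0 => //.
      by apply: mulr_ge0; [exact: ltW|apply: mulr_ge0; exact: ltW].
    apply: lee_sum => ij ne; rewrite /pair pair_arrival// EFinM.
    apply: lee_pmul => //; last exact: first_arrival_le.
    rewrite (le_trans (two _ _ (x / q) z _ _ _ _ _))// lee_fin ler_pM2l//.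
    exact: dil.
  rewrite sumEFin lee_fin sumr_const card_prod card_ord -[leLHS]mulr_natr /e'.
  rewrite [leLHS](_ : _ = e / 2 * G (kappa * x) * lam t)//.
  by field; rewrite !gt_eqF.
have PE3 : (P E3 <= (e / 2 * G (kappa * x) * lam t)%:E)%E.
  apply: le_trans (many x t x1x tS).
  have mUE3 : measurable E3 by exact: bigcup_measurable.
  apply: (le_trans (measure_sigma_subadditive P mE3 mUE3 (fun _ => id))).
  rewrite [leRHS]eseries_cond [leRHS]eseries_mkcond; apply: lee_nneseries => //.
  move=> n _; rewrite /=; case: ifPn => mn; last by rewrite measure0.
  apply: (le_trans (probability_bigsetU_le P _ _ (fun i : 'I_n.+1 => mclaim_of n i))).
  apply: (@le_trans _ _ (\sum_(i < n.+1) ((G (x / (n.+1%:R * b)))%:E *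
      P [set w | (tau n.+1 w <= t)%R]))%E).
    by apply: lee_sum => i _; rewrite claim_arrival// divr_gt0 ?mulr_gt0.
  rewrite -(fineK (fin_num_measure P _ (measurable_arrival tau n.+1 t))).
  rewrite -!EFinM sumEFin lee_fin sumr_const card_ord -[leLHS]mulr_natr.
  by rewrite mulrC mulrA.
rewrite (P_restr mE).
apply: (@le_trans _ _ (P (E1 `|` E2 `|` E3))).
  apply: le_measure; rewrite ?inE//; first exact: measurableI.
  by apply: measurableU; [exact: measurableU|exact: bigcup_measurable].
apply: (le_trans (measureU2 P (measurableU _ _ mE1 mE2) (bigcup_measurable (fun n _ => mE3 n)))).
apply: (@le_trans _ _ (P E1 + P E2 + P E3)%E).
  by rewrite leeD2r// measureU2.
rewrite -addeA; apply: leeD => //.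
apply: (le_trans (leeD PE2 PE3)).
by rewrite -EFinD lee_fin -2!mulrDl -splitr.
Qed.

(** Lower bound: by Bonferroni's inequality, as two large discounted claims
    seldom occur together. *)
Lemma jump_series_le (e K : R) : 0 < e -> 0 < K -> exists x0, 0 < x0 /\
  forall x t E, x0 <= x -> t <= S -> measurable E ->
  (forall i, jump (x + K) t i `&` Om `<=` E) ->
  (\sum_(i <oo) P (jump (x + K) t i) <= P E + (e * G (kappa * x) * lam t)%:E)%E.
Proof.
move=> e0 K0; have e20 : 0 < e / 2 by rewrite divr_gt0.
have [m [x1 [x10 many]]] := many_claims_negligible e20.
have [C [x2 [C0 x20 dil]]] := tail_dilation_exp ltr01.
pose C' := C * expR (1 * 1%:R).
have C'0 : 0 < C' by rewrite mulr_gt0 ?expR_gt0.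
pose e' := e / 2 / (m.+1 * m.+1)%:R / C'.
have e'0 : 0 < e' by rewrite !divr_gt0.
have [z z0 two] := two_large_claims m.+1 e'0.
exists (z * b + x1 + x2); split; first by rewrite !addr_gt0// mulr_gt0.
move=> x t E x0x tS mE Esup.
have zb0 : 0 < z * b by rewrite mulr_gt0.
have zx : z * b <= x by rewrite (le_trans _ x0x)// -addrA lerDl ltW ?addr_gt0.
have x1x : x1 <= x by rewrite (le_trans _ x0x)// addrAC lerDr ltW ?addr_gt0.
have x2x : x2 <= x by rewrite (le_trans _ x0x)// lerDr ltW ?addr_gt0.
have x0 : 0 < x by apply: lt_le_trans zx.
have xK0 : 0 < x + K by rewrite addr_gt0.
have xb0 : 0 < x / b by rewrite divr_gt0.
have xbK : x / b <= (x + K) / b by rewrite ler_pM2r ?invr_gt0// lerDl ltW.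
have zxb : z <= x / b by rewrite ler_pdivlMr.
have Gx0 : 0 < G (kappa * x) by rewrite G_gt0// mulr_gt0.
pose B i := jump (x + K) t i `&` Om.
have mB i : measurable (B i) by apply: measurableI => //; exact: measurable_jump.
rewrite (nneseries_split 0 m); last by move=> k _; exact: measure_ge0.
rewrite add0n big_mkord.
have head : (\sum_(i < m) P (jump (x + K) t i) <=
    P E + (e / 2 * G (kappa * x) * lam t)%:E)%E.
  rewrite (eq_bigr (fun i : 'I_m => P (B i))); last first.
    by move=> i _; rewrite [LHS]P_restr//; exact: measurable_jump.
  apply: (le_trans (bonferroni P mB m)); apply: leeD.
    apply: le_measure; rewrite ?inE//; first exact: bigsetU_measurable.
    by rewrite -bigcup_mkord; apply: bigcup_sub => i _; exact: Esup.
  pose a := e' * (C' * G (kappa * x)) * lam t.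
  have a0 : 0 <= a.
    apply: mulr_ge0 => //.
    by apply: mulr_ge0; [exact: ltW|apply: mulr_ge0; exact: ltW].
  have BB i j : (i < m)%N -> (j < i)%N -> (P (B i `&` B j) <= a%:E)%E.
    move=> im ji.
    apply: (@le_trans _ _ (P ([set w | scale_set (x / b) A (X i w)] `&`
        [set w | scale_set (x / b) A (X j w)] `&` [set w | tau 1%N w <= t]))).
      apply: le_measure; rewrite ?inE; first exact: measurableI.
        by apply: measurableI; [apply: measurableI; exact: mX|exact: measurable_arrival].
      move=> w [/(jump_le xK0 tS)[/= Xi taui] /(jump_le xK0 tS)[/= Xj _]].
      split; last exact: first_arrival taui.
      by split; exact: (scale_set_le hA xb0 xbK).
    rewrite pair_arrival// /a EFinM; apply: lee_pmul => //; last exact: first_arrival_le.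
    rewrite (le_trans (two _ _ (x / b) (x / b) _ _ _ _ _))//.
    - by rewrite ltnW// ltnS.
    - by rewrite ltnW// ltnS (ltn_trans ji).
    - by rewrite gtn_eqF.
    - rewrite lee_fin ler_pM2l//.
      by have := dil 0%N x x2x; rewrite mul1r.
  apply: (@le_trans _ _ (\sum_(i < m) (a *+ m.+1)%:E)%E).
    apply: lee_sum => i _; apply: (@le_trans _ _ (\sum_(j < i) a%:E)%E).
      by apply: lee_sum => j _; apply: BB.
    rewrite sumEFin lee_fin sumr_const card_ord -[leLHS]mulr_natr -[leRHS]mulr_natr.
    by rewrite ler_wpM2l// ler_nat (leq_trans (ltnW (ltn_ord i))).
  rewrite sumEFin lee_fin sumr_const card_ord -mulrnA -[leLHS]mulr_natr.
  apply: (@le_trans _ _ (a * (m.+1 * m.+1)%:R)).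
    by rewrite ler_wpM2l// ler_nat leq_mul2l/= leqnSn.
  rewrite [leLHS](_ : _ = e / 2 * G (kappa * x) * lam t)// /a /e'.
  by field; rewrite !gt_eqF.
have rest : (\sum_(m <= i <oo) P (jump (x + K) t i) <=
    (e / 2 * G (kappa * x) * lam t)%:E)%E.
  apply: le_trans (many x t x1x tS).
  apply: lee_nneseries => // i _.
  rewrite P_restr; last exact: measurable_jump.
  apply: (@le_trans _ _ (P ([set w | scale_set ((x + K) / b) A (X i w)] `&`
      [set w | tau i.+1 w <= t]))).
    apply: le_measure; rewrite ?inE; first exact: mB.
      by apply: measurableI; [apply: mX; exact: lt_le_trans xbK|exact: measurable_arrival].
    exact: jump_le.
  rewrite claim_arrival; last exact: lt_le_trans xbK.
  apply: lee_pmul => //.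
    by rewrite lee_fin ltW// G_gt0// (lt_le_trans xb0).
  rewrite lee_fin; apply: (@le_trans _ _ (G (x / (i.+1%:R * b)))).
    apply: G_anti; first by rewrite divr_gt0 ?mulr_gt0.
    rewrite (le_trans _ xbK)// invfM mulrCA ler_piMl ?(ltW xb0)//.
    by rewrite invf_le1 ?ltr0n// ler1n.
  by rewrite ler_peMl ?ler1n// ltW// G_gt0// divr_gt0 ?mulr_gt0.
apply: (le_trans (leeD head rest)).
by rewrite -addeA leeD2l// -EFinD lee_fin -2!mulrDl -splitr.
Qed.

End one_big_jump.

(** * Almost sure bounds of the return process *)

Section bounded_paths.
Context {R : realType} {dT : measure_display} {T : measurableType dT}.
Context {P : probability T R}.
Variables (xi : R -> {RV P >-> R}) (S : R).
Hypothesis xi_cadlag : forall w, cadlag (fun t => xi t w).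
Hypothesis S0 : 0 < S.

Lemma measurable_path_in (B : set R) : closed B ->
  measurable [set w | forall s, 0 <= s <= S -> B (xi s w)].
Proof.
move=> cB; have mB s : measurable [set w | B (xi s w)].
  have := measurable_funPT (xi s) measurableT _ (closed_measurable cB).
  by rewrite setTI.
have -> : [set w | forall s, 0 <= s <= S -> B (xi s w)] =
    [set w | B (xi 0 w)] `&`
    ~` [set w | exists2 s, s \in `]0, S] & (~` [set w | B (xi s w)]) w].
  apply/seteqP; split => w /=.
    move=> Bw; split; first by apply: Bw; rewrite lexx ltW.
    by move=> [s]; rewrite in_itv/= => /andP[s0 sS]; apply; apply: Bw; rewrite ltW.
  move=> [B0 nB] s /andP[]; rewrite le_eqVlt => /predU1P[<-//|s0] sS.
  by apply: contrapT => nBs; apply: nB; exists s => //; rewrite in_itv/= s0.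
apply: measurableI => //; apply: measurableC.
apply: (measurable_hitting (E := fun s => ~` [set w | B (xi s w)])) => //.
  by move=> s _; exact: measurableC.
move=> s w s0 /= nB; have /(_ (~` B)) := (xi_cadlag w).1 s s0; apply.
by apply: open_nbhs_nbhs; split => //; exact: closed_openC.
Qed.

Variables C1 C2 : R.
Hypothesis infxi : P [set w | ((- C1)%:E <=
  ereal_inf [set (xi t w)%:E | t in `[0%R, S]])%E] = 1%E.
Hypothesis supxi : P [set w | (ereal_sup [set (xi t w)%:E | t in `[0%R, S]] <=
  C2%:E)%E] = 1%E.

Definition bounded_paths := [set w | forall s, 0 <= s <= S -> - C1 <= xi s w] `&`
  [set w | forall s, 0 <= s <= S -> xi s w <= C2].

Let mlow : measurable [set w | forall s, 0 <= s <= S -> - C1 <= xi s w].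
Proof. exact: (measurable_path_in (@closed_ge _ (- C1))). Qed.

Let mup : measurable [set w | forall s, 0 <= s <= S -> xi s w <= C2].
Proof. exact: (measurable_path_in (@closed_le _ C2)). Qed.

Lemma measurable_bounded_paths : measurable bounded_paths.
Proof. exact: measurableI. Qed.

Lemma bounded_paths_as : P bounded_paths = 1%E.
Proof.
have low1 : P [set w | forall s, 0 <= s <= S -> - C1 <= xi s w] = 1%E.
  rewrite -infxi; congr (P _); apply/seteqP; split => w /= xiC.
    by apply: le_ereal_inf_tmp => _ [s /= sS <-]; rewrite lee_fin xiC//; rewrite in_itv in sS.
  move=> s sS; rewrite -lee_fin (le_trans xiC)//; apply: ereal_inf_lbound.
  by exists s => //=; rewrite in_itv.
have up1 : P [set w | forall s, 0 <= s <= S -> xi s w <= C2] = 1%E.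
  rewrite -supxi; congr (P _); apply/seteqP; split => w /= xiC.
    by apply: ge_ereal_sup => _ [s /= sS <-]; rewrite lee_fin xiC//; rewrite in_itv in sS.
  move=> s sS; rewrite -lee_fin (le_trans _ xiC)//; apply: ereal_sup_ubound.
  by exists s => //=; rewrite in_itv.
apply/eqP; rewrite eq_le probability_le1//=; last exact: measurable_bounded_paths.
rewrite -[leLHS]low1 /bounded_paths.
rewrite [leLHS](measureDI P mlow mup).
rewrite [X in (X + _)%E](_ : _ = 0%E) ?add0e//.
apply/eqP; rewrite eq_le measure_ge0 andbT.
have <- : P (~` [set w | forall s, 0 <= s <= S -> xi s w <= C2]) = 0%E.
  by rewrite probability_setC// up1 subee.
apply: le_measure; rewrite ?inE; [exact: measurableD|exact: measurableC|].
by move=> w [].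
Qed.

End bounded_paths.

(** * Uniform asymptotics of the ruin probability *)

Lemma relative_error_le {R : realFieldType} (e p phi : R) : 0 < e -> 0 < phi ->
  p <= (1 + e) * phi + e * phi -> phi <= (1 + e) * (p + e * phi) ->
  `|p / phi - 1| <= e + e.
Proof.
move=> e0 phi0 up low; rewrite ler_distl; apply/andP; split; last first.
  by rewrite ler_pdivrMr//; nra.
rewrite ler_pdivlMr// -(ler_pM2l (_ : 0 < 1 + e)) ?addr_gt0//.
(* [(1 - 2 * e) * (1 + e) <= 1 - e - e ^+ 2] *)
have := mulr_ge0 (ltW e0) (ltW phi0).
have := mulr_ge0 (ltW e0) (mulr_ge0 (ltW e0) (ltW phi0)).
by nra.
Qed.

Lemma uniformly_equivalent_le {R : realType} (D : set R) (f g : R -> R -> R) :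
  (forall e, 0 < e -> exists x0, forall x t, x0 <= x -> D t ->
    `|f x t / g x t - 1| <= e) ->
  uniformly_equivalent D f g.
Proof.
move=> fg; rewrite /uniformly_equivalent; set h := fun x => ereal_sup _.
have h0 x : (0 <= h x)%E by apply: ereal_sup_ubound; right.
have he e : 0 < e -> \forall x \near +oo%R, (h x <= e%:E)%E.
  move=> e0; have [x0 x0P] := fg e e0.
  exists x0; split=> [|x x0x]; first exact: num_real.
  apply: ge_ereal_sup => _ [[t Dt <-]|->]; last by rewrite lee_fin ltW.
  by rewrite lee_fin; apply: x0P => //; exact: ltW.
apply/fine_cvgP; split.
  apply: filterS (he _ ltr01) => x hx.
  by rewrite ge0_fin_numE// (le_lt_trans hx)// ltry.
apply/cvgrPdist_le => e e0; apply: filterS (he _ e0) => x hx.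
rewrite sub0r normrN ger0_norm ?fine_ge0// -lee_fin fineK//.
by rewrite ge0_fin_numE// (le_lt_trans hx)// ltry.
Qed.

Theorem corollary3p1 (R : realType) (dT : measure_display)
  (T : measurableType dT) (P : probability T R) (d : nat)
  (X : nat -> {RV P >-> 'rV[R]_d})
  (tau : nat -> {RV P >-> R}) (N : R -> T -> nat)
  (lam : cumulative R R)
  (xi : R -> {RV P >-> R})
  (c : R -> T -> 'rV[R]_d) (M : 'rV[R]_d)
  (l : 'rV[R]_d) (L : set 'rV[R]_d)
  (F : probability 'rV[R]_d R) (X0 : {RV P >-> 'rV[R]_d}) :
  let A := minus_set l L in
  (forall n w, nonneg_vec (X n w) /\ X n w != 0) ->
  renewal_counting_process tau N ->
  renewal_function P N lam ->
  (forall w, xi 0 w = 0) ->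
  (forall w, cadlag (fun t => xi t w)) ->
  measurable_fun [set p : measurableTypeR R * T | 0 <= p.1]
    (fun p => c p.1 p.2) ->
  (forall t w k, 0 <= t -> 0 <= c t w 0 k <= M 0 k) ->
  (forall k, 0 < l 0 k) ->
  \sum_k l 0 k = 1 ->
  ruin_set L ->
  (forall S : R, 0 < S -> exists C1 C2 : R,
    [/\ 0 <= C1, C1 <= C2,
        P [set w | ((- C1)%:E <=
            ereal_inf [set (xi t w)%:E | t in `[0%R, S]])%E] = 1%E
      & P [set w | (ereal_sup [set (xi t w)%:E | t in `[0%R, S]] <=
            C2%:E)%E] = 1%E]) ->
  (forall n, has_law P (X n) F) ->
  class_DL_on A F ->
  (forall i j, i != j ->
    tail_asymptotically_independent P (Y_ A \o X i) (Y_ A \o X j)) ->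
  mutually_independent_seq P
    [:: sigma_of setT X;
        sigma_of [set t | 0 <= t] N;
        sigma_of [set t | 0 <= t] xi;
        sigma_of [set t | 0 <= t] c] ->
  has_law P X0 F ->
  mutually_independent_seq P
    [:: sigma_of setT (fun _ : unit => X0);
        sigma_of [set t | 0 <= t] xi] ->
  forall S : R, 0 < S ->
  uniformly_equivalent [set t | 0 < t <= S /\ 0 < lam t]
    (fun x t => fine (P (ruin_event X tau N xi c l L x t)))
    (fun x t => fine (\int[lebesgue_stieltjes_measure lam]_(s in `[0%R, t])
      P [set w | scale_set x A (expR (- xi s w) *: X0 w)]%R)%E).
Proof.
move=> A X_pos tauN lamE xi0 xi_cadlag mc c_bounded l0 l1 ruinL xi_bounded X_law [F_D F_L]
  tai indep X0_law indep0 S S0.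
have hA : scrR A by exact: ruin_set_scrR.
have X_ge0 n w : nonneg_vec (X n w) by have [] := X_pos n w.
have [C1 [C2 [C10 C12 infxi supxi]]] := xi_bounded S S0.
pose Om := bounded_paths xi S C1 C2.
have mOm : measurable Om by exact: measurable_bounded_paths.
have POm : P Om = 1%E by exact: bounded_paths_as.
have xi_Om w : Om w -> forall s, 0 <= s <= S -> - C1 <= xi s w <= C2.
  by move=> [low up] s sS; rewrite low// up.
pose G := tail (law_on F A).
have indepXN EX n t : sigma_of setT X EX ->
    P (EX `&` [set w | tau n.+1 w <= t]) = (P EX * P [set w | (tau n.+1 w <= t)%R])%E.
  exact: (indep_claims_arrival tauN indep).
have D_le i w : Om w -> tau i.+1 w <= S -> discount tau xi i w <= expR C1.
  move=> Omw tauS; rewrite ler_expR lerNl.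
  have := xi_Om w Omw (tau i.+1 w); rewrite (arrival_ge0 tauN) tauS.
  by move=> /(_ isT)/andP[].
have D_gt0 i w : 0 < discount tau xi i w by exact: expR_gt0.
have PsiE u t : 0 < u ->
    (\sum_(i <oo) P (big_claim X tau xi A u t i))%E = tail_integral xi lam A X0 u t.
  by move=> u0; exact: (big_claim_series hA tauN lamE xi_cadlag X_law indep X0_law indep0).
apply: uniformly_equivalent_le => e e0; pose e' := e / 2.
have e'0 : 0 < e' by rewrite divr_gt0.
have [K K0 ruinK] := large_claim_ruin X_ge0 tauN xi_cadlag mc c_bounded l0 ruinL C1 S0.
have [h [x1 [h0 hx1 upper]]] := large_total_le hA X_ge0 tauN lamE X_law F_D tai indepXN
  D_gt0 (measurable_discount tauN xi_cadlag) (expR_gt0 C2) (expR_gt0 C1) mOm POm D_le e'0.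
have [x2 [x20 lower]] := jump_series_le hA X_ge0 tauN lamE X_law F_D tai indepXN
  D_gt0 (measurable_discount tauN xi_cadlag) (expR_gt0 C2) (expR_gt0 C1) mOm POm D_le e'0 K0.
have [x3 hx3 shift_h] := tail_integral_shift lam hA xi_cadlag X0_law indep0
  mOm POm xi_Om F_L e'0 h0.
(* The lower bound concerns the level [x + K], from which [x] is recovered by a
   shift. *)
have [x4 Kx4 shift_K] := tail_integral_shift lam hA xi_cadlag X0_law indep0
  mOm POm xi_Om F_L e'0 K0.
exists (Num.max x1 (Num.max x2 (Num.max x3 x4))) => x t.
rewrite !ge_max => /and4P[x1x x2x x3x x4x] [/andP[t0 tS] lamt].
have x0 : 0 < x by exact: lt_le_trans x2x.
have xh : 0 < x - h by rewrite subr_gt0 (lt_le_trans hx1).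
have xK : 0 < x + K by exact: addr_gt0.
have x4xK : x4 <= x + K by rewrite (le_trans x4x)// lerDl ltW.
set E := ruin_event _ _ _ _ _ _ _ _ _.
have mE : measurable E := measurable_ruin X tauN xi_cadlag mc c_bounded l0 ruinL x0 t0.
have jumpE i : big_claim X tau xi A (x + K) t i `&` Om `<=` E.
  move=> w [[taut Zw] Omw]; apply: (ruinK x t w i) => //; last by rewrite t0.
  by move=> s sS; have /andP[] := xi_Om w Omw s sS.
have up : (P E <= \sum_(i <oo) P (big_claim X tau xi A (x - h) t i) +
    (e' * G (expR C2 * x) * lam t)%:E)%E.
  apply: (upper x t E x1x tS mE) => w.
  exact: (ruin_total_claims X_ge0 tauN c_bounded l0 ruinL x0).
have low : (\sum_(i <oo) P (big_claim X tau xi A (x + K) t i) <=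
    P E + (e' * G (expR C2 * x) * lam t)%:E)%E.
  exact: (lower x t E x2x tS mE).
have Gl := tail_integral_ge hA tauN lamE xi_cadlag X0_law indep0 mOm POm xi_Om x0 tS.
have PsiF := tail_integral_fin X0 hA tauN lamE xi_cadlag t x0.
have Gx : 0 < G (expR C2 * x) by case: F_D => + _; apply.
have PEF : P E \is a fin_num by exact: fin_num_measure.
have := shift_h x t x3x tS; have := shift_K (x + K) t x4xK tS; rewrite addrK.
move: up low; rewrite !PsiE//.
have PsihF := tail_integral_fin X0 hA tauN lamE xi_cadlag t xh.
have PsiKF := tail_integral_fin X0 hA tauN lamE xi_cadlag t xK.
move: Gl.
rewrite -(fineK PEF) -(fineK PsiF) -(fineK PsihF) -(fineK PsiKF).
set p := fine (P E); set phi := fine (tail_integral _ _ _ _ x t).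
set phih := fine _; set phiK := fine _.
rewrite -!EFinM -!EFinD !lee_fin => Gphi up low shK shh.
change (`|p / phi - 1| <= e).
have phi0 : 0 < phi by apply: lt_le_trans Gphi; rewrite mulr_gt0.
have e'G : e' * G (expR C2 * x) * lam t <= e' * phi.
  by rewrite -mulrA ler_pM2l.
rewrite [e]splitr -/e'; apply: relative_error_le => //.
  by rewrite (le_trans up)// lerD.
by rewrite (le_trans shK)// ler_pM2l ?addr_gt0// (le_trans low)// lerD2l.
Qed.
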